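(* For every $n\ge1$, the poset, under the painted growth order, of painted trees with $n+1$ leaves consisting of weakly ordered forests grafted to corollas is isomorphic to the face poset of the graph cubeahedron of the complete graph $K_n$ on $n$ nodes, i.e. to the poset $(\mathcal{J}K_n)_r$ of marked tubings of $K_n$ modulo the equivalence defined in the context.
   Context: **Plane and painted trees.** A plane tree is a finite rooted plane tree in which every node has at least two (linearly ordered) inputs; inputs not coming from another node are leaves, numbered $0,1,\dots,n$ from left to right; the root has an output edge. A node $w$ is strictly above a node $v$ if $v\neq w$ lies on the path from $w$ to the root. A weak order on a set of nodes is a total preorder (an ordered partition into levels), always required to satisfy: if $w$ is strictly above $v$ then the level of $w$ comes strictly after the level of $v$. A painted tree is a plane tree each of whose nodes is declared painted, half-painted or unpainted, such that if $w$ is strictly above $v$ and $v$ is half-painted or unpainted, then $w$ is unpainted. Let $W_n$ be the set of painted trees with $n+1$ leaves equipped with a weak order on the painted nodes and a weak order on all unpainted nodes. A weakly ordered forest grafted to a corolla is a painted tree with at most one painted node, equipped with a weak order on the set of all unpainted nodes; let $X_n$ be the set of those with $n+1$ leaves. The forgetful map $p:W_n\to X_n$ forgets the weak order of the painted nodes and contracts every edge joining two painted nodes. **Painted growth order.** For $t\in W_n$, gap $i$ ($1\le i\le n$) ends at the node where the paths from leaves $i-1$ and $i$ to the root first meet. $\pi(t)$ is the ordered partition of $\{0,\dots,n\}$ listing: in order, the blocks of gaps ending at painted nodes of each level; then the block of $0$ and all gaps ending at half-painted nodes; then, in order, the blocks of gaps ending at unpainted nodes of each level. $\pi(s)$ refines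 $\pi(t)$ if it is obtained by replacing each block by an ordered partition of that block. A growth step in $X_n$ (growing internal edges, then forgetting superfluous structure) passes from $x$ to $y$ if there are $t,s\in W_n$ with $p(t)=x$, $p(s)=y$ and $\pi(s)$ refining $\pi(t)$. Then $y\preceq x$ iff $y$ is obtained from $x$ by a finite (possibly empty) sequence of growth steps. **Marked tubings.** For a finite connected simple graph $G$, a tube is a nonempty set of nodes inducing a connected subgraph; the set of all nodes is the universal tube. Two tubes are compatible if one contains the other or if they are disjoint and their union is not a tube. A tubing is a set of pairwise compatible tubes containing the universal tube. A marked tube is a tube marked thin, thick or broken. A marked tubing is a tubing with each tube marked, such that whenever $u\subsetneq v$ are tubes of it and $v$ is not thick, then $u$ is thin. Marked tubings are partially ordered by $U\preceq U'$ if $U$ is obtained from $U'$ by a finite sequence of the following moves, each resulting in a marked tubing: (1) a broken tube becomes thin or thick; (2) a thin tube is added inside a thin or broken tube; (3) a thick tube is added inside a thick tube; (4) a collection of compatible broken tubes $u_1,\dots,u_k$ is added simultaneously inside a broken tube $v$, with each $u_i$ closely nested in $v$ (no tube of the tubing strictly between $u_i$ and $v$), and $v$ becomes thick. **Graph cubeahedron.** The graph cubeahedron of a connected graph $G$ is (up to combinatorial equivalence) the polytope $\mathcal{J}G_r$ whose face poset is the poset of marked tubings modulo the equivalence relation generated by $U\sim V$ whenever $U$ is obtained from $V$ by adding a thick tube inside a thick tube (with the order induced on classes). *)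

(* Defs.v *)
From HB Require Import structures.
From Stdlib Require Relations.
From mathcomp Require Import all_boot generic_quotient.

Set Implicit Arguments.
Unset Strict Implicit.
Unset Printing Implicit Defensive.

Local Open Scope quotient_scope.

(* A weak order with m levels on the painted (resp. unpainted) nodes is encoded
   by its rank function onto {0, .., m-1}: [Painted k] (resp. [Unpainted k])
   labels the painted (resp. unpainted) nodes of level k. *)
Inductive label := Painted of nat | HalfPainted | Unpainted of nat.

Definition label_code l : option (nat + nat) :=
  match l with
  | Painted k => Some (inl k)
  | HalfPainted => None
  | Unpainted k => Some (inr k)
  end.
Definition label_decode c :=
  match c with
  | Some (inl k) => Painted k
  | None => HalfPainted
  | Some (inr k) => Unpainted k
  end.
Lemma label_codeK : cancel label_code label_decode. Proof. by case. Qed.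
HB.instance Definition _ := Equality.copy label (can_type label_codeK).

Definition painted_level l := if l is Painted k then Some k else None.
Definition unpainted_level l := if l is Unpainted k then Some k else None.

Inductive ptree := Leaf | Node of label & seq ptree.

(* The address of a node or leaf is the sequence of child indices on the path
   from the root to it. *)
Definition address := seq nat.

(* All leaves ([None]) and labelled nodes ([Some l]) with their addresses;
   the leaves occur from left to right. *)
Fixpoint vertices (t : ptree) : seq (address * option label) :=
  match t with
  | Leaf => [:: ([::], None)]
  | Node l ts =>
      ([::], Some l) ::
      (fix children (i : nat) (us : seq ptree) {struct us} :=
         if us is u :: us' then
           [seq (i :: v.1, v.2) | v <- vertices u] ++ children i.+1 us'
         else [::]) 0 ts
  end.

Definition leaves t : seq address := [seq v.1 | v <- vertices t & v.2 == None].
Definition nodes t : seq (address * label) :=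
  pmap (fun v => omap (pair v.1) v.2) (vertices t).

Definition strictly_above (w v : address) := (v != w) && prefix v w.

Fixpoint plane t :=
  if t is Node _ ts then (1 < size ts) && all plane ts else true.

Definition painted_tree t :=
  plane t &&
  all (fun v => all (fun w =>
         strictly_above w.1 v.1 && ~~ painted_level v.2 ==> unpainted_level w.2)
       (nodes t)) (nodes t).

(* [lev] selects the nodes carrying the weak order. *)
Definition levels (lev : label -> option nat) t : seq nat :=
  pmap (fun v => lev v.2) (nodes t).

Definition weak_order (lev : label -> option nat) t :=
  all (fun k => all (fun j => j \in levels lev t) (iota 0 k)) (levels lev t) &&
  all (fun v => all (fun w => strictly_above w.1 v.1 ==>
         if (lev v.2, lev w.2) is (Some i, Some j) then i < j else true)
       (nodes t)) (nodes t).

Definition is_W n t :=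
  [&& painted_tree t, size (leaves t) == n.+1,
      weak_order painted_level t & weak_order unpainted_level t].
Definition W n := {t : ptree | is_W n t}.

(* [levels painted_level t] has one entry per painted node; the weak order on
   at most one painted node carries no information. *)
Definition is_X n t := is_W n t && (size (levels painted_level t) <= 1).
Definition X n := {t : ptree | is_X n t}.

(* The map p : W_n -> X_n.  In a painted tree no node above a half-painted or
   unpainted node is painted, so only painted nodes call for recursion. *)
Fixpoint forget (t : ptree) : ptree :=
  if t is Node (Painted _) ts then
    Node (Painted 0)
      (flatten [seq (if forget u is Node (Painted _) us then us
                     else [:: forget u]) | u <- ts])
  else t.

(* The paths from two vertices to the root first meet at the vertex whose
   address is the longest common prefix. *)
Fixpoint meet (a b : address) : address :=
  match a, b with
  | i :: a', j :: b' => if i == j then i :: meet a' b' else [::]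
  | _, _ => [::]
  end.

Definition gap_end t i : address :=
  meet (nth [::] (leaves t) i.-1) (nth [::] (leaves t) i).

Definition gap_block n t (l : label) : {set 'I_n.+1} :=
  [set i : 'I_n.+1 | (0 < i) && ((gap_end t i, l) \in nodes t)].

Definition num_levels lev t := size (undup (levels lev t)).

Definition gap_partition n (t : W n) : seq {set 'I_n.+1} :=
  [seq gap_block n (val t) (Painted k)
     | k <- iota 0 (num_levels painted_level (val t))]
  ++ (ord0 |: gap_block n (val t) HalfPainted)
  :: [seq gap_block n (val t) (Unpainted k)
     | k <- iota 0 (num_levels unpainted_level (val t))].

Definition ordered_partition (T : finType) (P : seq {set T}) (B : {set T}) :=
  uniq P && partition [set C in P] B.

Definition refines (T : finType) (P Q : seq {set T}) :=
  exists2 Ps : seq (seq {set T}),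
    P = flatten Ps & all2 (@ordered_partition T) Ps Q.

Definition growth_step n (x y : X n) :=
  exists t s : W n,
    [/\ forget (val t) = val x, forget (val s) = val y
      & refines (gap_partition s) (gap_partition t)].

Definition growth_le n (y x : X n) : Prop :=
  Relation_Operators.clos_refl_trans (X n) (@growth_step n) x y.

Record sgraph := SGraph {
  vertex :> finType;
  edge : rel vertex;
  edge_sym : symmetric edge;
  edge_irr : irreflexive edge
}.

Lemma neq_sym (T : eqType) : symmetric (fun x y : T => x != y).
Proof. by move=> x y; rewrite eq_sym. Qed.
Lemma neq_irr (T : eqType) : irreflexive (fun x y : T => x != y).
Proof. by move=> x; rewrite eqxx. Qed.
Definition complete_graph n : sgraph :=
  SGraph (@neq_sym 'I_n) (@neq_irr 'I_n).

Inductive mark := Thin | Thick | Broken.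

Definition mark_code m : option bool :=
  match m with Thin => None | Thick => Some true | Broken => Some false end.
Definition mark_decode c :=
  match c with None => Thin | Some true => Thick | Some false => Broken end.
Lemma mark_codeK : cancel mark_code mark_decode. Proof. by case. Qed.
HB.instance Definition _ := Finite.copy mark (can_type mark_codeK).

Section Tubings.
Variable G : sgraph.

Definition tube (u : {set G}) :=
  (u != set0) &&
  [forall x in u, forall y in u,
     connect [rel a b | [&& a \in u, b \in u & edge a b]] x y].

Definition compatible (u v : {set G}) :=
  [|| u \subset v, v \subset u | [disjoint u & v] && ~~ tube (u :|: v)].

Definition tubing (A : {set {set G}}) :=
  [&& [forall u in A, tube u], setT \in A
    & [forall u in A, forall v in A, compatible u v]].

(* [U u = None] means that [u] is not in the tubing. *)
Definition premarked := {ffun {set G} -> option mark}.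

Definition tubes (U : premarked) : {set {set G}} := [set u | U u != None].

Definition is_marked_tubing (U : premarked) :=
  tubing (tubes U) &&
  [forall u in tubes U, forall v in tubes U,
     (u \proper v) && (U v != Some Thick) ==> (U u == Some Thin)].

Definition marked_tubing := {U : premarked | is_marked_tubing U}.

Definition set_mark (U : premarked) (A : {set {set G}}) (m : mark) : premarked :=
  [ffun t => if t \in A then Some m else U t].

Definition resolve_broken (V U : marked_tubing) :=
  exists (u : {set G}) (m : mark), [/\ val V u = Some Broken, m != Broken
                & val U = set_mark (val V) [set u] m].

Definition add_thin (V U : marked_tubing) :=
  exists u v : {set G}, [/\ u \proper v, val V u = None,
                  val V v = Some Thin \/ val V v = Some Broken
                & val U = set_mark (val V) [set u] Thin].

Definition add_thick : rel marked_tubing := fun V U =>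
  [exists u : {set G}, exists v : {set G}, [&& u \proper v, val V u == None,
                  val V v == Some Thick
                & val U == set_mark (val V) [set u] Thick]].

Definition closely_nested (U : premarked) (u v : {set G}) :=
  (u \proper v) && [forall w in tubes U, ~~ ((u \proper w) && (w \proper v))].

Definition split_broken (V U : marked_tubing) :=
  exists (v : {set G}) (A : {set {set G}}),
    [/\ val V v = Some Broken,
        forall u, u \in A -> val V u = None /\ closely_nested (val U) u v
      & val U = set_mark (set_mark (val V) A Broken) [set v] Thick].

(* [move V U]: U is obtained from V by one move. *)
Definition move (V U : marked_tubing) : Prop :=
  [\/ resolve_broken V U, add_thin V U, add_thick V U | split_broken V U].

Definition tubing_le (U V : marked_tubing) : Prop :=
  Relation_Operators.clos_refl_trans marked_tubing move V U.

Definition thick_equiv : rel marked_tubing :=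
  connect (fun U V => add_thick U V || add_thick V U).

Lemma thick_equiv_refl : reflexive thick_equiv.
Proof. by move=> U; exact: connect0. Qed.
Lemma thick_equiv_sym : symmetric thick_equiv.
Proof. by apply: sym_connect_sym => U V /=; rewrite orbC. Qed.
Lemma thick_equiv_trans : transitive thick_equiv.
Proof. exact: connect_trans. Qed.
Canonical thick_equivalence : equiv_rel marked_tubing :=
  EquivRel thick_equiv thick_equiv_refl thick_equiv_sym thick_equiv_trans.

Definition cubeahedron_face := {eq_quot thick_equivalence}.

(* The induced order on classes is the least preorder for which the quotient
   map is monotone. *)
Definition face_step (c d : cubeahedron_face) : Prop :=
  exists U V : marked_tubing,
    [/\ c = \pi_cubeahedron_face U, d = \pi_cubeahedron_face V
      & tubing_le U V].

Definition face_le (c d : cubeahedron_face) : Prop :=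
  Relation_Operators.clos_refl_trans cubeahedron_face face_step c d.

End Tubings.

Definition poset_isomorphic (S T : Type)
    (leS : S -> S -> Prop) (leT : T -> T -> Prop) : Prop :=
  [/\ Relation_Definitions.order S leS, Relation_Definitions.order T leT
    & exists2 f : S -> T, bijective f & forall x y, leS x y <-> leT (f x) (f y)].

(* Main.v *)
(** Read from left to right, the labels of the nodes at which the gaps end
determine a tree with levels, since the gaps of least label end at the root.
For x in X_n, let N be the set of gaps not ending at a painted node, and let
the thin sets be the nonempty final segments of the weak order of the gaps
ending at unpainted nodes. Then x is determined by N and by the chain of thin
sets, which is an arbitrary chain of nonempty subsets of N; growing enlarges
the chain and shrinks N.

Any two disjoint tubes of K_n have a tube as union, so a tubing of K_n is a
chain. A marked tubing consists, from the largest tube down, of thick tubes, at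
most one broken tube, and thin tubes. Its class forgets the thick tubes and
is given by the chain of thin tubes together with the union N of the nonthick
tubes (N is broken unless it is empty or thin). The moves again enlarge
the chain or shrink N, so both posets are isomorphic to that of pairs
(chain, N). *)

Require Import Defs.
From mathcomp Require Import all_boot generic_quotient zify.

Set Implicit Arguments.
Unset Strict Implicit.
Unset Printing Implicit Defensive.

(** * Trees and their gap labels *)

(** Both orders hide choices: a growth step quantifies over lifts to [W n], the order on faces over
    representatives of classes. On the tree side the choice of lifts can be eliminated, because the
    weak order of the painted gaps is free: [x] is its own lift, and two painted levels in the lift
    of [y] are enough. What remains is the condition [grows] on label sequences. It is transitive,
    so any sequence of growth steps amounts to a single one. On the tubing side a move need not be a
    single step between flags in any canonical way. That moves are monotone for flags is checked
    move by move; conversely, every class has a representative in which no tube but the universal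
    one is thick, and between such representatives a comparison of flags is realised by explicit
    moves. Antisymmetry of the two reflexive transitive closures is never attacked directly: it is
    inherited from inclusion of flags. *)

Lemma ptree_nth_ind (P : ptree -> Prop) :
    P Leaf -> (forall l ts, (forall i, P (nth Leaf ts i)) -> P (Node l ts)) ->
  forall t, P t.
Proof.
move=> PL PN; fix IH 1; case=> [|l ts]; first exact: PL.
by apply: PN; elim: ts => [|u us IHus] [|i]; [exact: PL | exact: PL | exact: IH | exact: IHus].
Qed.

(** The order in which the blocks of the painted growth order are listed, with a single half-painted
    block in the middle. *)
Definition label_lt (l l' : label) : bool :=
  match l, l' with
  | Painted i, Painted j => i < j
  | Painted _, _ => true
  | HalfPainted, Unpainted _ => true
  | Unpainted i, Unpainted j => i < j
  | _, _ => false
  end.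
Definition label_le (l l' : label) : bool := (l == l') || label_lt l l'.

Lemma Painted_eq i j : (Painted i == Painted j) = (i == j).
Proof. by apply/eqP/eqP => [[]|->]. Qed.
Lemma Unpainted_eq i j : (Unpainted i == Unpainted j) = (i == j).
Proof. by apply/eqP/eqP => [[]|->]. Qed.
Lemma label_neq :
  ((forall k, (Painted k == HalfPainted) = false) *
   (forall k, (HalfPainted == Painted k) = false) *
   (forall k, (Unpainted k == HalfPainted) = false) *
   (forall k, (HalfPainted == Unpainted k) = false) *
   (forall j k, (Painted j == Unpainted k) = false) *
   (forall j k, (Unpainted j == Painted k) = false))%type.
Proof. by []. Qed.
Definition label_eqE := (Painted_eq, Unpainted_eq, label_neq).

Lemma label_le_refl : reflexive label_le.
Proof. by move=> l; rewrite /label_le eqxx. Qed.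
Lemma label_leNlt l l' : label_le l l' = ~~ label_lt l' l.
Proof.
case: l l' => [i||i] [j||j]; rewrite /label_le /= ?label_eqE ?eqxx //; lia.
Qed.
Lemma label_le_total : total label_le.
Proof.
case=> [i||i] [j||j]; rewrite /label_le /= ?label_eqE ?eqxx //; lia.
Qed.
Lemma label_le_trans : transitive label_le.
Proof.
case=> [i||i] [j||j] [k||k]; rewrite /label_le /= ?label_eqE ?eqxx //; lia.
Qed.
Lemma label_le_anti : antisymmetric label_le.
Proof.
case=> [i||i] [j||j]; rewrite /label_le /= ?label_eqE ?eqxx //.
- by move=> H; congr Painted; lia.
- by move=> H; congr Unpainted; lia.
Qed.
Lemma label_ltxx l : label_lt l l = false.
Proof. by case: l => [i||i] //=; rewrite ltnn. Qed.

Definition painted l := isSome (painted_level l).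
Definition unpainted l := isSome (unpainted_level l).

(* [behead] drops the separator in front of the first subtree. *)
Fixpoint gap_labels (t : ptree) : seq label :=
  if t is Node l ts then behead (flatten [seq l :: gap_labels u | u <- ts])
  else [::].

Fixpoint increasing (t : ptree) : bool :=
  if t is Node l ts then
    all (fun u => all (label_lt l) (gap_labels u) && increasing u) ts
  else true.

(** The default [Leaf] carries no label, so a child index out of range gives [None]; addresses can
    then be handled by induction over all indices, without bounds. *)
Fixpoint label_at (t : ptree) (a : address) {struct a} : option label :=
  match t, a with
  | Leaf, _ => None
  | Node l _, [::] => Some l
  | Node _ ts, i :: a' => label_at (nth Leaf ts i) a'
  end.

(** A named form of the anonymous inner fixpoint of [vertices], general enough to serve [nodes] as
    well. *)
Fixpoint graft_from (A : Type) (F : ptree -> seq (address * A)) k us :=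
  if us is u :: us' then
    [seq (k :: v.1, v.2) | v <- F u] ++ graft_from F k.+1 us'
  else [::].

Lemma vertices_Node l ts :
  vertices (Node l ts) = ([::], Some l) :: graft_from vertices 0 ts.
Proof.
rewrite /=; congr cons; elim: ts 0 => [|u us IH] k //=.
by rewrite IH.
Qed.

Lemma nodes_Node l ts : nodes (Node l ts) = ([::], l) :: graft_from nodes 0 ts.
Proof.
rewrite /nodes vertices_Node /=; congr cons.
elim: ts 0 => [|u us IH] k //=; rewrite pmap_cat IH; congr cat.
by elim: (vertices u) => [|[a [l'|]] s IHs] //=; rewrite IHs.
Qed.

Fixpoint leaves_from k us : seq address :=
  if us is u :: us' then map (cons k) (leaves u) ++ leaves_from k.+1 us'
  else [::].

Lemma leaves_Node l ts : leaves (Node l ts) = leaves_from 0 ts.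
Proof.
rewrite /leaves vertices_Node /=.
elim: ts 0 => [|u us IH] k //=; rewrite filter_cat map_cat IH /leaves; congr cat.
by elim: (vertices u) => [|[a [l'|]] s IHs] //=; rewrite IHs.
Qed.

Lemma mem_graft_nodes us k a l :
    (forall i a l, ((a, l) \in nodes (nth Leaf us i)) =
                   (label_at (nth Leaf us i) a == Some l)) ->
  ((a, l) \in graft_from nodes k us) =
  if a is j :: a' then (k <= j) && (label_at (nth Leaf us (j - k)) a' == Some l)
  else false.
Proof.
elim: us k a => [|u us IH] k a H /=.
  by case: a => [|j a] //; rewrite nth_nil; case: a => [|? ?]; rewrite andbF.
rewrite mem_cat IH; last by move=> i; exact: (H i.+1).
case: a => [|j a]; first by rewrite orbF; apply/mapP => -[].
have -> : ((j :: a, l) \in [seq (k :: v.1, v.2) | v <- nodes u]) =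
          (j == k) && ((a, l) \in nodes u).
  apply/mapP/andP => [[[b l'] /= Hb [-> -> ->]] | [/eqP -> H']]; first by rewrite eqxx.
  by exists (a, l).
rewrite (H 0); case: (ltngtP k j) => [kj|//|->] /=; last by rewrite subnn orbF.
by rewrite -(subnSK kj).
Qed.

Lemma mem_nodes t a l : ((a, l) \in nodes t) = (label_at t a == Some l).
Proof.
elim/ptree_nth_ind: t a l => [[|i a]|l0 ts IH a l] //.
rewrite nodes_Node inE (mem_graft_nodes _ _ _ IH) {IH}.
by case: a => [|i a] /=; rewrite ?subn0 // orbF xpair_eqE eqxx eq_sym.
Qed.

Lemma size_flatten_cons (A : Type) (l : A) (rs : seq (seq A)) :
  size (flatten [seq l :: r | r <- rs]) = sumn (map size rs) + size rs.
Proof. by elim: rs => //= r rs IH; rewrite size_cat IH; lia. Qed.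

(** A subtree together with the separator in front of it contributes as many labels as it has
    leaves; [behead] then removes one label. *)
Lemma size_leaves t : plane t -> size (leaves t) = (size (gap_labels t)).+1.
Proof.
elim/ptree_nth_ind: t => // l ts IH /andP[Hts /all_nthP Hpl].
rewrite leaves_Node /= size_behead.
have : forall i, i < size ts ->
    size (leaves (nth Leaf ts i)) = (size (gap_labels (nth Leaf ts i))).+1.
  by move=> i Hi; exact: IH (Hpl _ _ Hi).
suff H us k : (forall i, i < size us ->
    size (leaves (nth Leaf us i)) = (size (gap_labels (nth Leaf us i))).+1) ->
    size (leaves_from k us) = size (flatten [seq l :: gap_labels u | u <- us]).
  move/(H _ 0) ->; case: ts Hts {IH Hpl H} => //= u us _; lia.
elim: us k => //= u us IHus k H; rewrite !size_cat size_map (H 0) //= IHus //.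
by move=> i; exact: (H i.+1).
Qed.

(** With at least two subtrees a separator survives [behead], so the label of the root itself
    occurs. *)
Lemma mem_behead_flatten (l0 l : label) (us : seq ptree) : 1 < size us ->
  (l \in behead (flatten [seq l0 :: gap_labels u | u <- us])) =
  (l == l0) || has (fun u => l \in gap_labels u) us.
Proof.
case: us => [|u [|v us]] //= _; rewrite mem_cat inE mem_cat.
have -> : (l \in flatten [seq l0 :: gap_labels w | w <- us]) =
          ((l == l0) && (0 < size us)) || has (fun w => l \in gap_labels w) us.
  elim: us => [|w us IH] /=; first by rewrite andbF.
  by rewrite inE mem_cat IH; case: (l == l0) => //=; rewrite ?orbT.
by case: (l == l0); rewrite /= ?orbT.
Qed.

Lemma label_at_size ts i a l :
  label_at (nth Leaf ts i) a = Some l -> i < size ts.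
Proof. by case: ltnP => // ?; rewrite nth_default //; case: a. Qed.

(** Every node has two neighbouring inputs, so some gap ends at it and no label is lost. *)
Lemma mem_gap_labels t l : plane t ->
  (l \in gap_labels t) <-> exists a, label_at t a = Some l.
Proof.
elim/ptree_nth_ind: t => [_|l0 ts IH /andP[Hts /all_nthP Hpl]].
  by split=> [|[[]]].
rewrite [gap_labels _]/= mem_behead_flatten //; split.
  case/orP => [/eqP ->|]; first by exists [::].
  move/(has_nthP Leaf) => [i Hi /(IH i (Hpl _ _ Hi)) [a Ha]].
  by exists (i :: a).
case=> -[[->]|i a /= Ha]; first by rewrite eqxx.
have Hi : i < size ts.
  exact: label_at_size Ha.
apply/orP; right; apply/(has_nthP Leaf); exists i => //.
by apply/(IH i (Hpl _ _ Hi)); exists a.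
Qed.

Lemma increasingP t : plane t ->
  increasing t <->
  forall a b l l', label_at t a = Some l -> label_at t b = Some l' ->
    strictly_above b a -> label_lt l l'.
Proof.
elim/ptree_nth_ind: t => [_|l0 ts IH /andP[Hts /all_nthP Hpl]].
  by split=> // _ [].
split=> [/all_nthP Hi|H].
  case=> [|i a] [|j b] l l' //=.
  - move=> [<-] Hb _; have Hj := label_at_size Hb.
    have /andP[/allP H _] := Hi Leaf j Hj; apply: H.
    by apply/(mem_gap_labels _ (Hpl _ _ Hj)); exists b.
  - rewrite /strictly_above eqseq_cons /= => Ha Hb.
    case: eqP => [ij|] //=.
    subst j; have Hj := label_at_size Hb.
    have /andP[_ Hinc] := Hi Leaf i Hj.
    by move: (iffLR (IH i (Hpl _ _ Hj)) Hinc) => HH; exact: HH.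
apply/(all_nthP Leaf) => i Hi; apply/andP; split.
  apply/allP => l /(mem_gap_labels _ (Hpl _ _ Hi)) [a Ha].
  exact: (H [::] (i :: a)).
apply/(IH i (Hpl _ _ Hi)) => a b l l' Ha Hb Hab.
apply: (H (i :: a) (i :: b)) => //.
by move: Hab; rewrite /strictly_above eqseq_cons /= eqxx.
Qed.

Definition downclosed (s : seq nat) :=
  all (fun k => all (fun j => j \in s) (iota 0 k)) s.

Lemma downclosedP s :
  reflect (forall k j, k \in s -> j < k -> j \in s) (downclosed s).
Proof.
apply: (iffP allP) => [H k j /H /allP Hk jk|H k Hk].
  by apply: Hk; rewrite mem_iota.
by apply/allP => j; rewrite mem_iota => /andP[_ jk]; exact: H Hk jk.
Qed.

Lemma eq_downclosed s1 s2 : s1 =i s2 -> downclosed s1 = downclosed s2.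
Proof.
by move=> E; apply/downclosedP/downclosedP => H k j; [rewrite -!E|rewrite !E]; exact: H.
Qed.

(** An initial segment of the naturals is determined by its cardinality; this ties the levels in use
    to [num_levels]. *)
Lemma mem_downclosed s k : downclosed s -> (k \in s) = (k < size (undup s)).
Proof.
move/downclosedP => H; apply/idP/idP => [Hk|].
  rewrite -[k.+1](size_iota 0); apply: uniq_leq_size (iota_uniq _ _) _ => j.
  rewrite mem_iota mem_undup /= add0n ltnS leq_eqVlt => /predU1P[->|] //.
  exact: H.
apply: contraLR => Hk; rewrite -leqNgt -[k](size_iota 0).
apply: uniq_leq_size (undup_uniq _) _ => j.
rewrite mem_undup mem_iota /= add0n => Hj; rewrite ltnNge leq_eqVlt.
apply: contra Hk => /predU1P[->|] //; exact: H.
Qed.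

Lemma levels_gap_labels lev t : plane t ->
  levels lev t =i pmap lev (gap_labels t).
Proof.
move=> Hp k; rewrite /levels !mem_pmap; apply/mapP/mapP => [[[a l] Hal E]|[l Hl E]].
  exists l => //; apply/(mem_gap_labels _ Hp).
  by exists a; apply/eqP; rewrite -mem_nodes.
have /(mem_gap_labels _ Hp) [a Ha] := Hl.
by exists (a, l) => //; rewrite mem_nodes Ha.
Qed.

Definition valid_labels n (s : seq label) :=
  [&& size s == n, downclosed (pmap painted_level s)
    & downclosed (pmap unpainted_level s)].

(** The painting condition compares nodes of different kinds and the weak orders compare nodes of
    the same kind; together they say that labels increase strictly away from the root. *)
Lemma is_WE n t :
  is_W n t = [&& plane t, increasing t & valid_labels n (gap_labels t)].
Proof.
rewrite /is_W /painted_tree /valid_labels /weak_order.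
case Hp: (plane t) => //=.
rewrite (size_leaves Hp) eqSS.
have Hd lev : all (fun k => all (fun j => j \in levels lev t) (iota 0 k))
    (levels lev t) = downclosed (pmap lev (gap_labels t)).
  exact: eq_downclosed (levels_gap_labels _ Hp).
rewrite !Hd; case: (_ == n); rewrite ?andbF //=.
case: (downclosed _); case: (downclosed _); rewrite ?andbF //= andbT.
apply/idP/idP => [/and3P[/allP Ha /allP Hb /allP Hc]|].
  apply/(increasingP Hp) => a b l l' /eqP; rewrite -mem_nodes => Hal /eqP.
  rewrite -mem_nodes => Hbl Hab.
  move: (allP (Ha _ Hal) _ Hbl) (allP (Hb _ Hal) _ Hbl) (allP (Hc _ Hal) _ Hbl).
  by rewrite /= Hab; case: (l) => [i||i]; case: (l') => [j||j].
move/(increasingP Hp) => H; apply/and3P; split; apply/allP => -[a l] Hal;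
  apply/allP => -[b l'] Hbl; apply/implyP => /=; 
  move: Hal Hbl; rewrite !mem_nodes => /eqP Hal /eqP Hbl.
- case/andP => Hab; have := H _ _ _ _ Hal Hbl Hab.
  by case: (l) => [i||i]; case: (l') => [j||j].
- move=> Hab; have := H _ _ _ _ Hal Hbl Hab.
  by case: (l) => [i||i]; case: (l') => [j||j].
- move=> Hab; have := H _ _ _ _ Hal Hbl Hab.
  by case: (l) => [i||i]; case: (l') => [j||j].
Qed.

(** Neighbouring leaves of one subtree meet inside it, while the last leaf of a subtree and the
    first leaf of the next meet at the root, exactly where the separator stands. [x0] is an
    arbitrary predecessor of the first leaf, and its entry is dropped. *)
Lemma label_at_meet t x0 : plane t ->
  behead (pairmap (fun a b => label_at t (meet a b)) x0 (leaves t)) =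
  map Some (gap_labels t).
Proof.
elim/ptree_nth_ind: t x0 => // l ts IH x0 /andP[_ /all_nthP Hpl].
set F := fun a b => _.
(* Here [z] is the leaf visited just before the subtrees with index at least [k]; it meets all their
   leaves at the root. Initially [[::]] plays this part. *)
suff H us k z :
    (forall i, nth Leaf us i = nth Leaf ts (k + i)) ->
    (forall j b, k <= j -> meet z (j :: b) = [::]) -> all plane us ->
    pairmap F z (leaves_from k us) =
    map Some (flatten [seq l :: gap_labels u | u <- us]).
  rewrite leaves_Node /= -behead_map -(H ts 0 [::]) //; first by case: leaves_from.
  by apply/(all_nthP Leaf) => i; exact: Hpl.
elim: us k z => //= u us IHus k z Hus Hz /andP[Hu Hall].
rewrite pairmap_cat map_cat.
have Eu : u = nth Leaf ts k by rewrite -[k]addn0 -Hus.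
have := size_leaves Hu; case E: (leaves u) => [|x s] //= _.
rewrite IHus //; first last.
- move=> j b kj; rewrite last_map /=; case: eqP => // kj'; lia.
- by move=> i; rewrite addSnnS -Hus.
congr (_ :: (_ ++ _)); first by rewrite /F Hz.
have := IH k x0; rewrite -Eu E /= => <- //.
elim: s {E} x => //= y s IHs x; rewrite IHs; congr (_ :: _).
by rewrite /F /= eqxx /= Eu.
Qed.

Lemma gap_end_label t i l : plane t -> 0 < i <= size (gap_labels t) ->
  ((gap_end t i, l) \in nodes t) = (nth HalfPainted (HalfPainted :: gap_labels t) i == l).
Proof.
case: i => //= i Hp Hi; rewrite mem_nodes /gap_end.
have := congr1 (fun s => nth None s i) (label_at_meet [::] Hp).
rewrite nth_behead (nth_pairmap [::]) ?size_leaves //.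
by rewrite (nth_map HalfPainted) //= => ->.
Qed.

Lemma gap_blockE n t l : plane t -> size (gap_labels t) = n ->
  gap_block n t l =
  [set i : 'I_n.+1 | (0 < i) && (nth HalfPainted (HalfPainted :: gap_labels t) i == l)].
Proof.
move=> Hp Hs; apply/setP => i; rewrite !inE; case: (posnP i) => //= Hi.
by rewrite gap_end_label // Hs Hi -ltnS ltn_ord.
Qed.

(** * Trees from label sequences *)

Definition least_label (s : seq label) :=
  foldr (fun l m => if label_le l m then l else m) (head HalfPainted s) s.

Fixpoint split_at (m : label) (s : seq label) : seq (seq label) :=
  if s is l :: s' then
    if l == m then [::] :: split_at m s'
    else (l :: head [::] (split_at m s')) :: behead (split_at m s')
  else [:: [::]].

(** The inverse of [gap_labels]: occurrences of the least label separate the subtrees of the root.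
    The pieces are strictly shorter than [s], so fuel at least the length of [s] suffices. *)
Fixpoint build (fuel : nat) (s : seq label) : ptree :=
  if fuel is k.+1 then
    if s is [::] then Leaf
    else Node (least_label s) [seq build k r | r <- split_at (least_label s) s]
  else Leaf.

Lemma least_labelP s : s != [::] ->
  least_label s \in s /\ forall l, l \in s -> label_le (least_label s) l.
Proof.
case: s => // a s _; rewrite /least_label /=; set m := foldr _ _ _.
have [Hm Hs] : m \in a :: s /\ forall l, l \in a :: s -> label_le m l.
  rewrite {}/m; elim: s => [|b s [IHm IHs]] /=.
    by rewrite inE; split=> // l; rewrite inE => /eqP ->; exact: label_le_refl.
  set m := foldr _ _ _ in IHm IHs *; case: ifP => H; split.
  - by rewrite !inE eqxx orbT.
  - move=> l; rewrite !inE => /or3P[/eqP->|/eqP->|Hl].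
    + by apply: label_le_trans H _; apply: IHs; rewrite mem_head.
    + exact: label_le_refl.
    + by apply: label_le_trans H _; apply: IHs; rewrite inE Hl orbT.
  - by move: IHm; rewrite !inE => /orP[->|->]; rewrite ?orbT.
  - move=> l; rewrite !inE => /or3P[/eqP->|/eqP->|Hl].
    + by apply: IHs; rewrite mem_head.
    + by have := label_le_total b m; rewrite H.
    + by apply: IHs; rewrite inE Hl orbT.
case: ifP => H; split => //; first by rewrite mem_head.
by move=> l /Hs; exact: label_le_trans.
Qed.

Lemma split_at_neq0 m s : split_at m s = head [::] (split_at m s) :: behead (split_at m s).
Proof. by case: s => [|l s] //=; case: ifP. Qed.

Lemma split_atK m s : behead (flatten [seq m :: r | r <- split_at m s]) = s.
Proof.
elim: s => [|l s IH] //=; case: eqP => [->|_] /=.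
  rewrite split_at_neq0 /= in IH *.
  by rewrite IH.
by rewrite split_at_neq0 /= in IH *; rewrite IH.
Qed.

Lemma mem_split_at m s r l : r \in split_at m s -> l \in r -> l \in s /\ l != m.
Proof.
elim: s r => [|a s IH] r /=; first by rewrite inE => /eqP ->.
case: eqP => [_|/eqP am].
  rewrite inE => /predU1P[->|Hr Hl] //.
  by have [Hs Hm] := IH r Hr Hl; rewrite inE Hs orbT.
have H : head [::] (split_at m s) \in split_at m s.
  by rewrite split_at_neq0 mem_head.
rewrite inE => /predU1P[->|Hr].
  rewrite !inE => /predU1P[->|Hl]; first by rewrite eqxx.
  by have [-> ->] := IH _ H Hl; rewrite orbT.
move=> Hl; have [] := IH r _ Hl; last by rewrite inE => -> ->; rewrite orbT.
by rewrite split_at_neq0 inE Hr orbT.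
Qed.

Lemma size_split_at m s : size (split_at m s) = (count_mem m s).+1.
Proof.
elim: s => //= a s IH; case: eqP => _ /=; first by rewrite IH.
by rewrite size_behead IH.
Qed.

Lemma size_mem_split_at m s r :
  m \in s -> r \in split_at m s -> size r < size s.
Proof.
move=> Hm Hr; rewrite -[X in _ < size X](split_atK m s) size_behead size_flatten_cons size_split_at addnS /=.
have := Hm; rewrite -has_pred1 has_count => H0.
have H1 : size r <= sumn (map size (split_at m s)).
  by elim: (split_at m s) Hr => //= a rs IH; rewrite inE => /predU1P[->|/IH]; lia.
by apply: leq_ltn_trans H1 _; rewrite -addn1 leq_add2l.
Qed.

Lemma buildK k s : size s <= k -> gap_labels (build k s) = s.
Proof.
elim: k s => [|k IH] s; first by rewrite leqn0 => /nilP ->.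
case Es: s => [|a s'] //; rewrite -Es => Hs.
have -> : build k.+1 s =
   Node (least_label s) [seq build k r | r <- split_at (least_label s) s].
  by rewrite Es.
have s0 : s != [::] by rewrite Es.
have [Hm _] := least_labelP s0; set m := least_label s in Hm *.
rewrite /= -map_comp -[RHS](split_atK m s); congr (behead (flatten _)).
apply/eq_in_map => r Hr /=; rewrite IH // -ltnS.
exact: leq_trans (size_mem_split_at Hm Hr) Hs.
Qed.

Lemma build_ok k s : size s <= k -> plane (build k s) && increasing (build k s).
Proof.
elim: k s => [|k IH] s //.
case Es: s => [|a s'] //; rewrite -Es => Hs.
have -> : build k.+1 s =
   Node (least_label s) [seq build k r | r <- split_at (least_label s) s].
  by rewrite Es.
have s0 : s != [::] by rewrite Es.
have [Hm Hle] := least_labelP s0; set m := least_label s in Hm Hle *.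
have Hk r : r \in split_at m s -> size r <= k.
  by move=> Hr; rewrite -ltnS; apply: leq_trans (size_mem_split_at Hm Hr) Hs.
rewrite /= size_map size_split_at ltnS -has_count has_pred1 Hm /=.
rewrite !all_map; apply/andP; split; apply/allP => r Hr /=.
  by have /andP[] := IH r (Hk r Hr).
have /andP[_ ->] := IH r (Hk r Hr); rewrite andbT buildK ?Hk //.
apply/allP => l Hl; have [/Hle Hls lm] := mem_split_at Hr Hl.
by move: Hls; rewrite /label_le eq_sym (negbTE lm).
Qed.

Lemma split_at_flatten m (us : seq (seq label)) :
  0 < size us -> all (all (fun l => l != m)) us ->
  split_at m (behead (flatten [seq m :: r | r <- us])) = us.
Proof.
case: us => //= r us _ /andP[Hr Hus].
have H us' : all (all (fun l => l != m)) us' ->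
    split_at m (flatten [seq m :: r' | r' <- us']) = [::] :: us'.
  elim: us' => //= r' us' IH /andP[Hr' /IH {}IH].
  rewrite eqxx; congr cons.
  elim: r' Hr' => //= a r' IHr /andP[/negbTE -> /IHr -> //].
elim: r Hr => [|a r IHr] /=; first by rewrite H.
by case/andP => /negbTE -> /IHr ->.
Qed.

Lemma least_labelE s m : m \in s -> (forall l, l \in s -> label_le m l) ->
  least_label s = m.
Proof.
move=> Hm Hle; have s0 : s != [::] by case: s Hm {Hle}.
have [H1 H2] := least_labelP s0.
by apply: label_le_anti; rewrite H2 // Hle.
Qed.

Lemma eq_map_nth (g : ptree -> ptree) ts :
  (forall i, i < size ts -> g (nth Leaf ts i) = nth Leaf ts i) -> map g ts = ts.
Proof.
elim: ts => //= t ts IH H; rewrite (H 0) // IH // => i; exact: (H i.+1).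
Qed.

(** In an increasing tree the root label is the least one and does not recur in the subtrees, so
    splitting at it returns exactly the label sequences of the subtrees. *)
Lemma gap_labelsK k t : plane t -> increasing t -> size (gap_labels t) <= k ->
  build k (gap_labels t) = t.
Proof.
elim/ptree_nth_ind: t k => [[]|l ts IH k /andP[Hts /(all_nthP Leaf) Hpl]] //.
move=> /(all_nthP Leaf) Hinc.
set s := gap_labels (Node l ts) => Hk.
have Hl : l \in s by rewrite /s /= mem_behead_flatten // eqxx.
have Hlt i l' : i < size ts -> l' \in gap_labels (nth Leaf ts i) -> label_lt l l'.
  by move=> /Hinc /andP[/allP H _] /H.
have Em : least_label s = l.
  apply: least_labelE => // l'; rewrite /s /= mem_behead_flatten //.
  case/orP => [/eqP->|/(has_nthP Leaf) [i Hi /(Hlt _ _ Hi) H]].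
    exact: label_le_refl.
  by rewrite /label_le H orbT.
have Es : split_at l s = [seq gap_labels u | u <- ts].
  have -> : s = behead (flatten [seq l :: r | r <- [seq gap_labels u | u <- ts]]).
    by rewrite -map_comp.
  rewrite split_at_flatten //; first by rewrite size_map; lia.
  rewrite all_map; apply/(all_nthP Leaf) => i Hi; apply/allP => l' /(Hlt _ _ Hi).
  by apply: contraTneq => ->; rewrite label_ltxx.
case: k Hk => [|k Hk].
  by rewrite leqn0 => /nilP Es0; rewrite Es0 in Hl.
have -> : build k.+1 s =
   Node (least_label s) [seq build k r | r <- split_at (least_label s) s].
  by rewrite /=; case: s Hl {Hk Em Es}.
rewrite Em Es -map_comp eq_map_nth // => i Hi /=.
apply: IH; [exact: Hpl | by case/andP: (Hinc i Hi) |].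
have := @size_mem_split_at l s (gap_labels (nth Leaf ts i)) Hl.
rewrite Es => H; rewrite -ltnS; apply: leq_trans Hk; apply: H.
by rewrite -(nth_map _ [::]) // mem_nth // size_map.
Qed.

(** * Forgetting the painted levels *)

Definition collapse l := if l is Painted _ then Painted 0 else l.

Lemma increasing_root l ts l' : plane (Node l ts) -> increasing (Node l ts) ->
  l' \in gap_labels (Node l ts) -> label_le l l'.
Proof.
move=> /andP[Hts _] /(all_nthP Leaf) Hinc; rewrite /= mem_behead_flatten //.
case/orP => [/eqP->|/(has_nthP Leaf) [i Hi H]]; first exact: label_le_refl.
have /andP[/allP H' _] := Hinc i Hi.
by rewrite /label_le H' ?orbT.
Qed.

Definition forget_pieces u :=
  if forget u is Node (Painted _) us then us else [:: forget u].

Definition forget_ok t := plane t -> increasing t ->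
  [/\ plane (forget t), increasing (forget t)
    & gap_labels (forget t) = map collapse (gap_labels t)].

(** When a painted child is dissolved into its parent, the separators between its own subtrees are
    already [Painted 0], so contraction does not disturb the sequence of separated labels. Below an
    unpainted or half-painted root nothing is painted and nothing changes. *)
Lemma forget_pieces_ok u : plane u -> increasing u -> forget_ok u ->
  [/\ 0 < size (forget_pieces u), all plane (forget_pieces u),
      all (fun v => all (label_lt (Painted 0)) (gap_labels v) && increasing v)
          (forget_pieces u)
    & flatten [seq Painted 0 :: gap_labels v | v <- forget_pieces u] =
      Painted 0 :: map collapse (gap_labels u)].
Proof.
move=> Hp Hi H; have {H} [] := H Hp Hi.
rewrite /forget_pieces; case: u Hp Hi => [|l us] Hp Hi //.
have Hnp : ~~ painted l -> 
  [/\ 0 < size [:: Node l us], all plane [:: Node l us],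
      all (fun v => all (label_lt (Painted 0)) (gap_labels v) && increasing v)
          [:: Node l us]
    & flatten [seq Painted 0 :: gap_labels v | v <- [:: Node l us]] =
      Painted 0 :: map collapse (gap_labels (Node l us))].
  move=> Hl.
  have Hnp l' : l' \in gap_labels (Node l us) -> ~~ painted l'.
    move/(increasing_root Hp Hi).
    by move: Hl; case: (l) => [i||i]; case: (l') => [j||j].
  have Hall : all (label_lt (Painted 0)) (gap_labels (Node l us)).
    by apply/allP => l' /Hnp; case: (l').
  split; rewrite ?all_seq1 //; first by rewrite Hall Hi.
  rewrite [LHS]/= cats0 -/(gap_labels (Node l us)); congr (_ :: _).
  rewrite -[LHS]map_id; apply/eq_in_map => l' /Hnp.
  by case: l'.
case: l Hp Hi Hnp => [j||j] Hp Hi Hnp; [|by move=> *; exact: Hnp..].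
rewrite [forget _]/=; set W := flatten _ => /andP[HW HpW] HiW E.
by rewrite -E; split=> //=; [lia | case: (W) HW].
Qed.

Lemma forgetP t : forget_ok t.
Proof.
elim/ptree_nth_ind: t => // l ts IH Hp Hi.
have Hnp : ~~ painted l -> gap_labels (Node l ts) = map collapse (gap_labels (Node l ts)).
  move=> Hl; rewrite -[LHS]map_id; apply/eq_in_map => l' /(increasing_root Hp Hi).
  by move: Hl; case: (l) => [i||i]; case: (l') => [j||j].
case: l Hp Hi Hnp => [k||k] Hp Hi Hnp; [|by split => //; exact: Hnp..].
have /andP[Hts /(all_nthP Leaf) Hpl] := Hp.
have /(all_nthP Leaf) Hinc := Hi.
have Hok i : i < size ts -> _ := fun Hi =>
  forget_pieces_ok (Hpl i Hi) (proj2 (andP (Hinc i Hi))) (IH i).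
rewrite [forget _]/= [map _ (_ _)]/= -/(forget_pieces).
change [seq _ | u <- ts] with (map forget_pieces ts).
have [H1 H2 H3 H4] :
  [/\ size ts <= size (flatten (map forget_pieces ts)),
      all plane (flatten (map forget_pieces ts)),
      all (fun v => all (label_lt (Painted 0)) (gap_labels v) && increasing v)
          (flatten (map forget_pieces ts))
    & flatten [seq Painted 0 :: gap_labels v | v <- flatten (map forget_pieces ts)] =
      map collapse (flatten [seq Painted k :: gap_labels u | u <- ts])].
  elim: (ts) Hok => //= u us IHus Hok.
  have [H1 H2 H3 H4] := Hok 0 isT.
  have [] := IHus; first by move=> i; exact: (Hok i.+1).
  move=> K1 K2 K3 K4.
  rewrite size_cat !all_cat map_cat flatten_cat H4 map_cat K4; split=> //; [by rewrite -add1n leq_add|exact/andP..].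
by split; rewrite /= ?H2 ?H3 ?H4 ?behead_map ?andbT //; exact: leq_trans H1.
Qed.

(** A painted level above 0 forces a second painted node at level 0. Conversely, labels beyond the
    root are strictly greater than the root label, hence never [Painted 0], so only the root can be
    painted. *)
Lemma is_XE n t :
  is_X n t = is_W n t && all (fun l => collapse l == l) (gap_labels t).
Proof.
rewrite /is_X; case HW: (is_W n t) => //=.
move: HW; rewrite is_WE => /and3P[Hp Hi /and3P[_ Hd _]].
have Hm k : (k \in levels painted_level t) = (Painted k \in gap_labels t).
  rewrite (levels_gap_labels painted_level Hp) mem_pmap.
  by apply/mapP/idP => [[[j||j] // Hj [->]]|Hk] //; exists (Painted k).
apply/idP/allP => [Hs [[|k]||k] //|H].
  rewrite -Hm => Hk.
  have H0 : 0 \in levels painted_level t.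
    rewrite (levels_gap_labels painted_level Hp).
    apply: (downclosedP _ Hd) (ltn0Sn k).
    by rewrite -(levels_gap_labels painted_level Hp).
  have : size [:: 0; k.+1] <= size (levels painted_level t).
    by apply: uniq_leq_size => // j; rewrite !inE => /orP[] /eqP ->.
  by move/leq_trans => /(_ _ Hs).
case: t Hp Hi H {Hd Hm} => // l ts Hp Hi H.
have Hb v : v \in graft_from nodes 0 ts -> painted_level v.2 = None.
  case: v => a l'; rewrite (mem_graft_nodes _ _ _ (fun i => @mem_nodes _)).
  case: a => // j a /= /eqP; rewrite subn0 => Ha.
  have Hj := label_at_size Ha; have /andP[_ /(all_nthP Leaf) Hpl] := Hp.
  have Hl' : l' \in gap_labels (nth Leaf ts j).
    by apply/mem_gap_labels; [exact: Hpl | exists a].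
  have /(all_nthP Leaf) Hi' := Hi; have /andP[/allP Hlt _] := Hi' j Hj.
  have := Hlt _ Hl'; have : collapse l' == l'.
    apply: H; rewrite /= mem_behead_flatten; last by case/andP: Hp.
    by apply/orP; right; apply/(has_nthP Leaf); exists j.
  by case: l' {Hl' Ha} => // i /eqP[<-]; case: (l).
rewrite /levels nodes_Node /=.
suff -> : pmap (fun v => painted_level v.2) (graft_from nodes 0 ts) = [::].
  by case: painted_level.
by elim: (graft_from _ _ _) Hb => //= v s IH Hb;
  rewrite Hb ?mem_head // IH // => w Hw; apply: Hb; rewrite inE Hw orbT.
Qed.

(** * Refinement of gap partitions *)

(** Gaps are numbered from 1; the extra entry at position 0 puts the element 0 into the half-painted
    block. *)
Definition lab (s : seq label) i := nth HalfPainted (HalfPainted :: s) i.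

(* Position of a label among the levels, the first [p] of which are painted. *)
Definition rank p l :=
  match l with Painted k => k | HalfPainted => p | Unpainted k => p.+1 + k end.

Definition num_labels (lev : label -> option nat) (s : seq label) := size (undup (pmap lev s)).

Section Ranks.
Variables (n : nat) (s : seq label).
Hypothesis Hs : valid_labels n s.
Let p := num_labels painted_level s.
Let q := num_labels unpainted_level s.

Lemma mem_painted_label k : (Painted k \in s) = (k < p).
Proof.
case/and3P: Hs => _ Hd _; rewrite -(mem_downclosed _ Hd) mem_pmap.
by apply/idP/mapP => [Hk|[[j||j] // Hj [->]]] //; exists (Painted k).
Qed.

Lemma mem_unpainted_label k : (Unpainted k \in s) = (k < q).
Proof.
case/and3P: Hs => _ _ Hd; rewrite -(mem_downclosed _ Hd) mem_pmap.
by apply/idP/mapP => [Hk|[[j||j] // Hj [->]]] //; exists (Unpainted k).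
Qed.

Lemma lab_mem i : i <= n -> lab s i = HalfPainted \/ lab s i \in s.
Proof.
case/and3P: Hs => /eqP Hsz _ _; case: i => [|i] Hi; first by left.
by right; rewrite /lab /= mem_nth // Hsz.
Qed.

Lemma painted_lab_bound i k : i <= n -> lab s i = Painted k -> k < p.
Proof. by move=> /lab_mem [->//|H E]; rewrite -mem_painted_label -E. Qed.
Lemma unpainted_lab_bound i k : i <= n -> lab s i = Unpainted k -> k < q.
Proof. by move=> /lab_mem [->//|H E]; rewrite -mem_unpainted_label -E. Qed.

Lemma leq_rank i j : i <= n -> j <= n ->
  (rank p (lab s i) <= rank p (lab s j)) = label_le (lab s i) (lab s j).
Proof.
move=> Hi Hj; have := @painted_lab_bound i; have := @painted_lab_bound j.
case: (lab s i) => [a||a]; case: (lab s j) => [b||b] Pj Pi;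
  try (have := Pi a Hi erefl); try (have := Pj b Hj erefl);
  rewrite /label_le /= ?label_eqE ?eqxx //; lia.
Qed.

Lemma lab_onto l : l \in s -> exists2 i, i <= n & lab s i = l.
Proof.
case/and3P: Hs => /eqP Hsz _ _ Hl; exists (index l s).+1; last exact: nth_index.
by rewrite -Hsz index_mem.
Qed.

Lemma rank_lt i : i <= n -> rank p (lab s i) < p + q.+1.
Proof.
move=> Hi; have := @painted_lab_bound i; have := @unpainted_lab_bound i.
case: (lab s i) => [a||a] U P /=; [have := P a Hi erefl| |have := U a Hi erefl]; lia.
Qed.

(** The half-painted block is never empty because it contains 0; the other levels are inhabited
    since levels form initial segments. *)
Lemma rank_onto k : k < p + q.+1 -> exists i : 'I_n.+1, rank p (lab s i) = k.
Proof.
move=> Hk; case: (ltngtP k p) => [kp|pk|->]; last by exists ord0.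
  have /lab_onto [i Hi E] : Painted k \in s by rewrite mem_painted_label.
  by exists (Ordinal (n:=n.+1) (m:=i) Hi); rewrite /= E.
have /lab_onto [i Hi E] : Unpainted (k - p.+1) \in s.
  rewrite mem_unpainted_label; lia.
exists (Ordinal (n:=n.+1) (m:=i) Hi); rewrite /= E /=; lia.
Qed.

End Ranks.

Definition fibers (T : finType) (f : T -> nat) m : seq {set T} :=
  [seq [set i | f i == k] | k <- iota 0 m].

Lemma gap_partitionE n (t : W n) :
  let s := gap_labels (val t) in
  gap_partition t =
  fibers (fun i : 'I_n.+1 => rank (num_labels painted_level s) (lab s i))
    (num_labels painted_level s + (num_labels unpainted_level s).+1).
Proof.
move=> s; have := valP t; rewrite is_WE => /and3P[Hp Hi Hs].
have Hnum lev : num_levels lev (val t) = num_labels lev s.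
  apply/perm_size/uniq_perm; rewrite ?undup_uniq // => k.
  by rewrite !mem_undup levels_gap_labels.
have Hsz : size s = n by case/and3P: Hs => /eqP.
rewrite /gap_partition /fibers !Hnum iotaD map_cat /= add0n.
set p := num_labels painted_level s.
have B i : i <= n -> (forall k, lab s i = Painted k -> k < p) := 
  fun Hi k => @painted_lab_bound n s Hs i k Hi.
congr (_ ++ (_ :: _)).
- apply/eq_in_map => k; rewrite mem_iota => /andP[_ /= Hk].
  rewrite gap_blockE //; apply/setP => i; rewrite !inE -/s -/(lab s i).
  have := @B i; rewrite -ltnS ltn_ord => /(_ isT).
  case: (posnP i) => [->|_] /=; first by move=> _; lia.
  case: (lab s i) => [a||a] _ /=; rewrite ?label_eqE //; lia.
- rewrite gap_blockE //; apply/setP => i; rewrite !inE -/s -/(lab s i).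
  rewrite -val_eqE /=.
  have := @B i; rewrite -ltnS ltn_ord => /(_ isT).
  case: (posnP i) => [->|_] /=; first by rewrite eqxx.
  case: (lab s i) => [a||a] /= H; [have := H _ erefl| |]; rewrite ?label_eqE ?eqxx //; lia.
- rewrite -[p.+1]addn0 iotaDl -map_comp; apply/eq_in_map => k _ /=.
  rewrite gap_blockE //; apply/setP => i; rewrite !inE -/s -/(lab s i).
  have := @B i; rewrite -ltnS ltn_ord => /(_ isT).
  case: (posnP i) => [->|_] /=; first by move=> _; lia.
  case: (lab s i) => [a||a] /= H; [have := H _ erefl| |]; rewrite ?label_eqE; lia.
Qed.

Lemma filter_monotone_cat (h : nat -> nat) c s :
  sorted leq (map h s) ->
  [seq k <- s | h k < c] ++ [seq k <- s | h k == c] = [seq k <- s | h k < c.+1].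
Proof.
elim: s => //= k s IH Hs; have Hs' := path_sorted Hs.
rewrite [h k < c.+1]ltnS; case: (ltngtP (h k) c) => Hk /=.
- by rewrite IH.
- by rewrite IH.
have E : [seq k0 <- s | h k0 < c] = [::].
  apply/eqP; rewrite -[_ == _]negbK -has_filter -all_predC.
  apply/allP => j Hj /=; rewrite -leqNgt -Hk.
  by have /allP := order_path_min leq_trans Hs; apply; apply: map_f.
by rewrite -IH // E.
Qed.

Lemma flatten_filter_monotone (h : nat -> nat) b s :
  sorted leq (map h s) -> all (fun k => h k < b) s ->
  flatten [seq [seq k <- s | h k == c] | c <- iota 0 b] = s.
Proof.
move=> Hs /all_filterP Hb; rewrite -[RHS]Hb; elim: b {Hb} => [|b IH].
  by rewrite /= filter_pred0.
rewrite -addn1 iotaD map_cat flatten_cat IH /= cats0 add0n addn1.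
exact: filter_monotone_cat.
Qed.

Section Refines.
Variables (T : finType) (f g : T -> nat) (a b : nat).
Hypotheses (f_lt : forall i, f i < a) (f_onto : forall k, k < a -> exists i, f i = k).
Hypotheses (g_lt : forall i, g i < b) (g_onto : forall k, k < b -> exists i, g i = k).

Lemma nth_fibers (h : T -> nat) m k : k < m ->
  nth set0 (fibers h m) k = [set i | h i == k].
Proof. by move=> Hk; rewrite (nth_map 0) ?size_iota // nth_iota. Qed.

(** A refinement groups the blocks of [f], in order, into runs whose unions are the blocks of [g];
    the index of the run is monotone in the position. Conversely, a monotone dependence of [g] on
    [f] cuts the list of blocks of [f] into such runs. *)
Lemma refines_fibers :
  refines (fibers f a) (fibers g b) <-> forall i j, f i <= f j -> g i <= g j.
Proof.
split=> [[Ps EP H] i j|H].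
  (* The entry at position [f k] of the flattened list lies in a run, and the union of that run is
     the block of [g] containing [k]. *)
  have Hg k : g k = reshape_index (shape Ps) (f k).
    have Hk : f k < size (flatten Ps) by rewrite -EP size_map size_iota.
    move: H; rewrite all2E => /andP[/eqP Hsz /allP Hall].
    have Hr : reshape_index (shape Ps) (f k) < size Ps.
      by rewrite -(size_map size) reshape_indexP // -size_flatten.
    set r := reshape_index _ _ in Hr *.
    have Hrb : r < b by move: Hr; rewrite Hsz size_map size_iota.
    have /Hall /= : (nth [::] Ps r, nth set0 (fibers g b) r) \in zip Ps (fibers g b).
      by rewrite -nth_zip // mem_nth // size_zip -Hsz minnn.
    case/andP => _ /cover_partition; rewrite nth_fibers // => Hcov.
    have : k \in cover [set C in nth [::] Ps r].
      apply/bigcupP; exists (nth set0 (flatten Ps) (f k)).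
        rewrite inE nth_flatten -/r mem_nth //.
        by rewrite -(nth_map _ 0 size) // reshape_offsetP // -size_flatten.
      by rewrite -EP nth_fibers // inE.
    by rewrite Hcov inE => /eqP.
  by rewrite !Hg (reshape_leq (shape Ps)) => /orP[/ltnW //|/andP[/eqP ->]].
(* The hypothesis applied both ways makes [g] constant on the fibers of [f]; 0 is a default for
   values that [f] does not attain. *)
have [h Hh] : exists h : nat -> nat, forall i, g i = h (f i).
  exists (fun k => if [pick i | f i == k] is Some i then g i else 0) => i.
  case: pickP => [j /eqP E|/(_ i)]; last by rewrite eqxx.
  by apply/eqP; rewrite eqn_leq !H // E.
exists [seq [seq [set i | f i == k] | k <- [seq k <- iota 0 a | h k == c]] | c <- iota 0 b].
  have -> : [seq [seq [set i | f i == k] | k <- [seq k <- iota 0 a | h k == c]] | c <- iota 0 b]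
    = map (map (fun k => [set i | f i == k])) [seq [seq k <- iota 0 a | h k == c] | c <- iota 0 b].
    by rewrite -map_comp.
  rewrite -map_flatten flatten_filter_monotone //.
    rewrite sorted_map.
    apply: (@sub_in_sorted _ (mem (iota 0 a)) leq _ _ _ _ (iota_sorted 0 a));
      last exact/allP.
    move=> k l.
    rewrite !mem_iota /= => /f_onto [i <-] /f_onto [j <-].
    by rewrite -!Hh => /H.
  by apply/allP => k; rewrite mem_iota /= => /f_onto [i <-]; rewrite -Hh.
rewrite all2E !size_map eqxx /= /fibers zip_map all_map.
apply/allP => c; rewrite mem_iota /= => Hc.
rewrite /ordered_partition map_inj_in_uniq ?filter_uniq ?iota_uniq //=; last first.
  move=> k l; rewrite !mem_filter !mem_iota /= => /andP[_ Hk] _ E.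
  have [i Hi] := f_onto Hk.
  have : i \in [set j | f j == k] by rewrite inE Hi.
  by rewrite E inE Hi => /eqP.
rewrite /partition; apply/and3P; split.
- rewrite eqEsubset; apply/andP; split; apply/subsetP => i.
    case/bigcupP => C; rewrite !inE => /mapP [k]; rewrite mem_filter => /andP[/eqP <- _] ->.
    by rewrite inE Hh => /eqP ->.
  rewrite inE => /eqP Hi; apply/bigcupP; exists [set j | f j == f i]; last by rewrite inE.
  by rewrite inE; apply: map_f; rewrite mem_filter mem_iota -Hh Hi eqxx /=.
- apply/trivIsetP => A B; rewrite !inE => /mapP[k _ ->] /mapP[l _ ->] Hkl.
  rewrite -setI_eq0; apply/eqP/setP => i; rewrite !inE.
  by apply/negP => /andP[/eqP Ek /eqP El]; rewrite -Ek -El eqxx in Hkl.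
- rewrite inE; apply/mapP => -[k]; rewrite mem_filter mem_iota /= => /andP[_ /f_onto [i Hi]].
  by move/setP/(_ i); rewrite !inE Hi eqxx.
Qed.

End Refines.

(** * The painted growth order on label sequences *)

Definition collapsed (s : seq label) := all (fun l => collapse l == l) s.

Lemma W_labelsP n (t : W n) : valid_labels n (gap_labels (val t)).
Proof. by have := valP t; rewrite is_WE => /and3P[]. Qed.

Lemma X_labelsP n (x : X n) :
  valid_labels n (gap_labels (val x)) /\ collapsed (gap_labels (val x)).
Proof. by have := valP x; rewrite is_XE is_WE => /andP[/and3P[]]. Qed.

Lemma build_W n s : valid_labels n s -> is_W n (build n s).
Proof.
move=> Hs; have Hsz : size s <= n by case/and3P: Hs => /eqP ->.
by rewrite is_WE buildK // Hs andbT build_ok.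
Qed.

Lemma build_X n s : valid_labels n s -> collapsed s -> is_X n (build n s).
Proof.
move=> Hs Hc; have Hsz : size s <= n by case/and3P: Hs => /eqP ->.
by rewrite is_XE build_W // buildK.
Qed.

Lemma is_W_inj n t u : is_W n t -> is_W n u ->
  gap_labels t = gap_labels u -> t = u.
Proof.
rewrite !is_WE => /and3P[Ht It /and3P[/eqP St _ _]] /and3P[Hu Iu /and3P[/eqP Su _ _]] E.
by rewrite -(@gap_labelsK n t) ?St // E gap_labelsK ?Su.
Qed.

Lemma X_inj n (x y : X n) :
  gap_labels (val x) = gap_labels (val y) -> x = y.
Proof.
move=> E; apply/val_inj; apply: (@is_W_inj n) => //.
  by have := valP x; rewrite is_XE => /andP[].
by have := valP y; rewrite is_XE => /andP[].
Qed.

Lemma forget_X n (t : W n) (x : X n) :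
  forget (val t) = val x <-> map collapse (gap_labels (val t)) = gap_labels (val x).
Proof.
have := valP t; rewrite is_WE => /and3P[Hp Hi _].
have [Hfp Hfi Hf] := forgetP Hp Hi.
split=> [<-|E] //.
have := valP x; rewrite is_XE is_WE => /andP[/and3P[Hpx Hix /and3P[/eqP Hs _ _]] _].
rewrite -(gap_labelsK Hfp Hfi (leqnn _)) Hf E.
exact: gap_labelsK.
Qed.

Lemma refines_W n (s t : W n) :
  refines (gap_partition s) (gap_partition t) <->
  forall i j, i <= n -> j <= n ->
    label_le (lab (gap_labels (val s)) i) (lab (gap_labels (val s)) j) ->
    label_le (lab (gap_labels (val t)) i) (lab (gap_labels (val t)) j).
Proof.
have Hs := W_labelsP s; have Ht := W_labelsP t.
rewrite !gap_partitionE; apply: iff_trans.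
  apply: refines_fibers.
  - by move=> i; apply: (rank_lt Hs); rewrite -ltnS.
  - exact: (rank_onto Hs).
  - by move=> i; apply: (rank_lt Ht); rewrite -ltnS.
split=> H i j.
  move=> Hi Hj; have := H (Ordinal (Hi : i < n.+1)) (Ordinal (Hj : j < n.+1)).
  by rewrite (leq_rank Hs) // (leq_rank Ht).
have Hb (k : 'I_n.+1) : k <= n by rewrite -ltnS.
rewrite (leq_rank Hs) ?(leq_rank Ht) //; exact: H.
Qed.

(* In [s] the weak order of [r] is refined, except that nothing is required
   among gaps which end at painted nodes of [s]. *)
Definition grows n (r s : seq label) := forall i j, i <= n -> j <= n ->
  ~~ painted (lab s j) -> label_le (lab s i) (lab s j) ->
  label_le (lab r i) (lab r j).

Lemma lab_collapse s i : lab (map collapse s) i = collapse (lab s i).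
Proof.
rewrite /lab; case: (ltnP i (size s).+1) => Hi.
  by rewrite -[HalfPainted :: map _ _]/(map collapse (HalfPainted :: s))
             (nth_map HalfPainted).
by rewrite !nth_default //= size_map.
Qed.

Lemma lab_collapsed s i : collapsed s -> collapse (lab s i) = lab s i.
Proof.
move=> Hs; rewrite -lab_collapse; congr (lab _ i).
by rewrite -[RHS]map_id; apply/eq_in_map => l /(allP Hs) /eqP.
Qed.

(** Comparison with 0, which is half-painted in both: a gap not painted in [s] does not precede 0
    there, hence not in [r] either. *)
Lemma grows_painted n r s i : grows n r s -> i <= n ->
  painted (lab r i) -> painted (lab s i).
Proof.
move=> H Hi Hr; apply: contraLR (Hr) => Hs.
have := H 0 i (leq0n n) Hi Hs; rewrite {1 3}/lab /=.
by move: Hs Hr; case: (lab s i) => [a||a]; case: (lab r i) => [b||b] // _ _ /(_ isT).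
Qed.

Lemma grows_trans n r s t : grows n r s -> grows n s t -> grows n r t.
Proof.
move=> Hrs Hst i j Hi Hj Ht Hij; apply: Hrs => //; last exact: Hst.
by apply: contra Ht; exact: grows_painted Hst Hj.
Qed.

Lemma label_le_collapse l l' : label_le l l' -> label_le (collapse l) (collapse l').
Proof.
by case: l l' => [i||i] [j||j]; rewrite /label_le /= ?label_eqE ?eqxx.
Qed.

(** Collapsing loses comparisons only among painted gaps, which [grows] leaves out; so every growth
    step satisfies it. For the converse [x] is its own lift, and the painted gaps of [y] are given a
    weak order [c] that refines that of [x]. *)
Lemma growth_stepP n (x y : X n) :
  growth_step x y <-> grows n (gap_labels (val x)) (gap_labels (val y)).
Proof.
have [Vx Cx] := X_labelsP x; have [Vy Cy] := X_labelsP y.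
set a := gap_labels (val x) in Vx Cx *; set b := gap_labels (val y) in Vy Cy *.
split=> [[t [s [/forget_X Ex /forget_X Ey /refines_W Hr]]] i j Hi Hj|H].
  rewrite /a /b -Ex -Ey !lab_collapse => Hp Hl.
  apply: label_le_collapse; apply: Hr => //.
  by move: Hp Hl; case: (lab _ i) => [c||c]; case: (lab _ j) => [d||d].
(* The gaps painted in [y] but not in [x] form a second painted level. *)
pose m := nat_of_bool (has painted a).
pose c := [seq if painted (lab b i) then Painted (if painted (lab a i) then 0 else m)
           else lab b i | i <- iota 1 n].
have Hc i : i <= n -> lab c i = if painted (lab b i) then
    Painted (if painted (lab a i) then 0 else m) else lab b i.
  case: i => [|i] Hi //; rewrite {1}/lab /= (nth_map 0) ?size_iota //.
  by rewrite nth_iota // add1n.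
have Sb : size b = n by case/and3P: Vy => /eqP.
have Sa : size a = n by case/and3P: Vx => /eqP.
have Eb : b = [seq lab b i | i <- iota 1 n].
  apply: (@eq_from_nth _ HalfPainted); rewrite ?size_map ?size_iota // => i.
  by rewrite Sb => Hi; rewrite (nth_map 0) ?size_iota // nth_iota // add1n.
(* If no gap is painted in [x] then [m] is 0, so level 0 is not skipped; otherwise a gap painted in
   [x] is also painted in [y] and occupies level 0. *)
have Vc : valid_labels n c.
  apply/and3P; split; first by rewrite size_map size_iota.
    apply/downclosedP => k j; rewrite !mem_pmap => /mapP [l Hl El] jk.
    have [i Hi El'] : exists2 i, i <= n & l = if painted (lab b i) then
       Painted (if painted (lab a i) then 0 else m) else lab b i.
      by move/mapP: Hl => [i]; rewrite mem_iota add1n ltnS => /andP[_ Hi] ->; exists i.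
    have : has painted a /\ j = 0.
      move: El jk; rewrite El'; case: ifP => [_ [->]|]; last by case: (lab b i).
      case: (painted (lab a i)) => //; rewrite /m.
      by case: (has painted a) => //=; case: (j).
    case=> /hasP [l0 Hl0 Hp0] ->.
    have [i0 Hi0 Ei0] := lab_onto Vx Hl0.
    apply/mapP; exists (lab c i0); last first.
      rewrite Hc // Ei0 Hp0 (@grows_painted n a b) //.
      by rewrite Ei0.
    case: i0 Hi0 Ei0 => [|i0] Hi0 Ei0; first by rewrite -Ei0 in Hp0.
    by rewrite /lab /= mem_nth // size_map size_iota.
  case/and3P: Vy => _ _; suff -> : pmap unpainted_level c = pmap unpainted_level b by [].
  rewrite [in RHS]Eb /c; elim: (iota 1 n) => //= i s ->.
  by case: (lab b i).
pose t : W n := exist _ (val x) (proj1 (andP (valP x))).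
pose s : W n := exist _ (build n c) (build_W Vc).
have Es : gap_labels (val s) = c by rewrite /= buildK // size_map size_iota.
exists t, s; split.
- apply/forget_X => /=; rewrite -[RHS]map_id; apply/eq_in_map => l /(allP Cx).
  by move/eqP.
- apply/forget_X; rewrite Es -/b Eb -map_comp; apply/eq_in_map => i _ /=.
  have := lab_collapsed i Cy; rewrite -/b.
  by case: (lab b i) => [k||k] //= <-.
- apply/refines_W => i j Hi Hj; rewrite Es /= -/a !Hc //.
  case Pj: (painted (lab b j)); last first.
    move=> Hl; apply: H => //; first by rewrite Pj.
    by move: Hl Pj; case: (lab b i) => [k||k]; case: (lab b j).
  case Pi: (painted (lab b i)); last first.
    by move: Pi; case: (lab b i).
  (* A gap painted in [y] precedes 0 there, so it cannot be unpainted in [x]. Among such gaps [x]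
     separates only painted from half-painted ones, and the levels of [c] respect this. *)
  have Hi0 : label_le (lab a i) HalfPainted.
    have := H i 0 Hi (leq0n n) isT; rewrite {1 4}/lab /= => -> //.
    by move: Pi; rewrite /lab; case: (nth _ _ i).
  have := lab_collapsed i Cx; have := lab_collapsed j Cx; rewrite -/a.
  have Hhas k : k <= n -> painted (lab a k) -> has painted a.
    move=> Hk Hp; have [E|Hm] := lab_mem Vx Hk; first by rewrite E in Hp.
    by apply/hasP; exists (lab a k).
  have := Hhas j Hj; move: Hi0.
  case: (lab a i) => [k||k]; case: (lab a j) => [l||l] //=.
  + by move=> _ _ [<-] [<-]; rewrite label_le_refl.
  + by rewrite /m => _ /(_ isT) ->.
Qed.

Lemma growth_leP n (x y : X n) :
  growth_le y x <-> grows n (gap_labels (val x)) (gap_labels (val y)).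
Proof.
split; last by move=> H; apply: Relation_Operators.rt_step; apply/growth_stepP.
elim=> [u v /growth_stepP|u|u v w _ Huv _ Hvw] //; exact: grows_trans Hvw.
Qed.

(** * Flags *)

Definition chain (T : finType) (A : {set {set T}}) :=
  [forall u in A, forall v in A, (u \subset v) || (v \subset u)].

Lemma chainP (T : finType) (A : {set {set T}}) :
  reflect {in A &, forall u v : {set T}, (u \subset v) || (v \subset u)} (chain A).
Proof.
apply: (iffP forall_inP) => H u.
  by move=> v Hu; apply/forall_inP: v; exact: H.
by move=> Hu; apply/forall_inP => v; exact: H.
Qed.

Lemma chain_min (T : finType) (A : {set {set T}}) (P : pred {set T}) u0 :
  chain A -> u0 \in A -> P u0 ->
  exists u, [/\ u \in A, P u & forall w, w \in A -> P w -> u \subset w].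
Proof.
move=> /chainP HA Hu0 HP0.
have H0 : (u0 \in A) && P u0 by rewrite Hu0.
case: (@arg_minnP _ u0 [pred u | (u \in A) && P u] (fun u : {set T} => #|u|) H0) => u /= /andP[Hu HP] Hmin.
exists u; split=> // w Hw Pw; have /orP[//|wu] := HA u w Hu Hw.
have E : w == u by rewrite eqEcard wu Hmin //= Hw.
by rewrite (eqP E).
Qed.

Lemma chain_max (T : finType) (A : {set {set T}}) (P : pred {set T}) u0 :
  chain A -> u0 \in A -> P u0 ->
  exists u, [/\ u \in A, P u & forall w, w \in A -> P w -> w \subset u].
Proof.
move=> /chainP HA Hu0 HP0.
have H0 : (u0 \in A) && P u0 by rewrite Hu0.
case: (@arg_maxnP _ u0 [pred u | (u \in A) && P u] (fun u : {set T} => #|u|) H0) => u /= /andP[Hu HP] Hmax.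
exists u; split=> // w Hw Pw; have /orP[uw|//] := HA u w Hu Hw.
have E : u == w by rewrite eqEcard uw Hmax //= Hw.
by rewrite (eqP E).
Qed.

(* In terms of marked tubings of K_n, a pair [(A, N)] consists of the set of
   thin tubes and of the union of all thin and broken tubes; it determines the
   class of the tubing. *)
Definition flag_data n := ({set {set 'I_n}} * {set 'I_n})%type.
Definition is_flag n (d : flag_data n) :=
  [forall u in d.1, (u != set0) && (u \subset d.2)] && chain d.1.
Definition flag n := {d : flag_data n | is_flag d}.

Lemma is_flagP n (d : flag_data n) :
  reflect [/\ forall u, u \in d.1 -> u != set0, forall u, u \in d.1 -> u \subset d.2
            & chain d.1] (is_flag d).
Proof.
apply: (iffP andP) => [[/forall_inP H Hc]|[H1 H2 Hc]].
  by split=> // u /H /andP[].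
by split=> //; apply/forall_inP => u Hu; rewrite H1 // H2.
Qed.

Definition flag_le n (d' d : flag n) : Prop :=
  (val d).1 \subset (val d').1 /\ (val d').2 \subset (val d).2.

Lemma flag_le_refl n (d : flag n) : flag_le d d. Proof. by []. Qed.
Lemma flag_le_trans n (d1 d2 d3 : flag n) :
  flag_le d1 d2 -> flag_le d2 d3 -> flag_le d1 d3.
Proof.
by move=> [H1 H2] [K1 K2]; split; [exact: subset_trans H1 | exact: subset_trans K2].
Qed.
Lemma flag_le_anti n (d1 d2 : flag n) : flag_le d1 d2 -> flag_le d2 d1 -> d1 = d2.
Proof.
move=> [H1 H2] [K1 K2]; apply/val_inj; case: (val d1) (val d2) H1 H2 K1 K2 => [A M] [B N] /= *.
by congr pair; apply/eqP; rewrite eqEsubset; apply/andP.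
Qed.

(** Node [j] of the complete graph stands for gap [j.+1]. For an unpainted gap this is the final
    segment that starts at its level. *)
Definition upset n (s : seq label) (j : 'I_n) : {set 'I_n} :=
  [set i : 'I_n | label_le (lab s j.+1) (lab s i.+1)].

Definition data_of_labels n (s : seq label) : flag_data n :=
  ([set upset s j | j in [set j : 'I_n | unpainted (lab s j.+1)]],
   [set j : 'I_n | ~~ painted (lab s j.+1)]).

Lemma label_le_unpainted l l' : unpainted l -> label_le l l' -> unpainted l'.
Proof. by case: l l' => [i||i] [j||j]. Qed.
Lemma unpaintedE l : unpainted l = ~~ label_le l HalfPainted.
Proof. by case: l. Qed.
Lemma data_of_labels_flag n s : is_flag (data_of_labels n s).
Proof.
apply/is_flagP; split=> /=.
- move=> u /imsetP[j _ ->]; apply/set0Pn; exists j; rewrite inE; exact: label_le_refl.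
- move=> u /imsetP[j]; rewrite inE => Hj ->; apply/subsetP => i; rewrite !inE.
  by move/(label_le_unpainted Hj); case: (lab _ _).
- apply/chainP => u v /imsetP[j _ ->] /imsetP[k _ ->].
  case/orP: (label_le_total (lab s j.+1) (lab s k.+1)) => H; apply/orP; [right|left];
    apply/subsetP => i; rewrite !inE; exact: label_le_trans.
Qed.

(** Growth makes every final segment of [r] a final segment of [s]. Conversely, if [j] came strictly
    before [i] in [r], the final segment of [r] starting at [i] would contain [i] but not [j]; being
    final in [s] too, it contradicts that [i] does not come after [j] in [s]. *)
Lemma growsP n r s :
  grows n r s <->
  (data_of_labels n r).1 \subset (data_of_labels n s).1 /\
  (data_of_labels n s).2 \subset (data_of_labels n r).2.
Proof.
split=> [H|[/subsetP H1 /subsetP H2] i j Hi Hj Hp Hl].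
  split; last first.
    apply/subsetP => j; rewrite !inE; apply: contra => Hp.
    exact: (@grows_painted n r s).
  have Hun (i : 'I_n) : unpainted (lab r i.+1) -> unpainted (lab s i.+1).
    rewrite !unpaintedE; apply: contra; exact: (H i.+1 0).
  apply/subsetP => u /imsetP[j]; rewrite inE => Hj ->{u}.
  have Pj : j \in upset r j by rewrite inE label_le_refl.
  (* An element of the segment that is least for [s] is where the same set starts as a final segment
     of [s]. *)
  have [k Hk Hmin] : exists2 k, k \in upset r j &
      forall i, i \in upset r j -> label_le (lab s k.+1) (lab s i.+1).
    pose m := least_label [seq lab s (val i).+1 | i <- enum (upset r j)].
    have [] := @least_labelP [seq lab s (val i).+1 | i <- enum (upset r j)].
      by have := Pj; rewrite -mem_enum; case: (enum _).
    case/mapP => k; rewrite mem_enum => Hk Ek Hle; exists k => // i Hi.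
    by rewrite -Ek; apply: Hle; apply/mapP; exists i; rewrite ?mem_enum.
  have Uk : unpainted (lab s k.+1).
    by apply: Hun; apply: label_le_unpainted Hj _; rewrite inE in Hk.
  apply/imsetP; exists k; first by rewrite inE.
  apply/eqP; rewrite eqEsubset; apply/andP; split; apply/subsetP => i Hi.
    by rewrite inE Hmin.
  rewrite !inE in Hk Hi *; apply: label_le_trans Hk _; apply: H => //.
  by move: (label_le_unpainted Uk Hi); case: (lab _ _).
have Hpj : ~~ painted (lab r j).
  case: j Hj Hp Hl => [|j] Hj // Hp _.
  by have := H2 (Ordinal Hj); rewrite !inE; apply.
rewrite label_leNlt; apply/negP => Hlt.
have Hui : unpainted (lab r i).
  by move: Hlt Hpj; case: (lab r i) => [k||k]; case: (lab r j) => [l||l].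
case: i Hi Hl Hlt Hui => [|i] Hi Hl Hlt Hui //.
have /H1 /imsetP[k] : upset r (Ordinal Hi) \in (data_of_labels n r).1.
  by apply/imsetP; exists (Ordinal Hi); rewrite // inE.
rewrite inE => Hk E.
have : Ordinal Hi \in upset r (Ordinal Hi) by rewrite inE label_le_refl.
rewrite E inE => Hki; have Hkj := label_le_trans Hki Hl.
have Huj := label_le_unpainted Hk Hkj.
case: j Hj Hp Hl Hpj Hlt Hkj Huj => // j Hj _ _ _ Hlt Hkj _.
have : Ordinal Hj \in upset s k by rewrite inE.
by rewrite -E inE label_leNlt Hlt.
Qed.

(** * Label sequences recovered from flags *)

Section LabelsOfFlag.
Variables (n : nat) (d : flag_data n).
Hypothesis Hd : is_flag d.

(** Later levels lie in more of the nested final segments, so the level of an unpainted gap is its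
    depth minus one. *)
Definition depth i := #|[set u in d.1 | i \in u]|.
Definition flag_label i :=
  if i \in d.2 then if depth i is k.+1 then Unpainted k else HalfPainted
  else Painted 0.
Definition flag_labels := [seq flag_label i | i <- enum 'I_n].

Lemma lab_flag_labels (i : 'I_n) : lab flag_labels i.+1 = flag_label i.
Proof. by rewrite /lab /= (nth_map i) ?size_enum_ord // nth_ord_enum. Qed.

Lemma depth_gt0 i u : u \in d.1 -> i \in u -> 0 < depth i.
Proof. by move=> Hu Hi; apply/card_gt0P; exists u; rewrite inE Hu. Qed.

Lemma depth_mem i : 0 < depth i -> i \in d.2.
Proof.
case/card_gt0P => u; rewrite inE => /andP[Hu Hi].
by have [_ /(_ _ Hu) /subsetP ->] := is_flagP _ Hd.
Qed.

Lemma unpainted_flag_label i : unpainted (flag_label i) = (0 < depth i).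
Proof.
by have := @depth_mem i; rewrite /flag_label; case: (i \in _); case: (depth i) => // k /(_ isT).
Qed.

Lemma label_le_flag i j : 0 < depth j ->
  label_le (flag_label j) (flag_label i) = (depth j <= depth i).
Proof.
move=> Hj; rewrite /flag_label (depth_mem Hj); have := @depth_mem i.
case: (depth j) Hj => // k _; case: (depth i) => [|l] H; first by case: (_ \in _).
by rewrite H // /label_le /= label_eqE; lia.
Qed.

Lemma minimal_member i : 0 < depth i ->
  exists u, [/\ u \in d.1, i \in u & forall w, w \in d.1 -> i \in w -> u \subset w].
Proof.
case/card_gt0P => u; rewrite inE => /andP[Hu Hi].
have [_ _ Hc] := is_flagP _ Hd.
exact: (@chain_min _ _ (fun w : {set 'I_n} => i \in w) u).
Qed.

(** Every member of the chain that contains [j] contains all of [u]. A point outside [u] lies only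
    in members that contain [u] strictly, and so in fewer of them. *)
Lemma depth_minimal j u i :
    u \in d.1 -> j \in u -> (forall w, w \in d.1 -> j \in w -> u \subset w) ->
  (i \in u) = (depth j <= depth i).
Proof.
move=> Hu Hj Hmin; have [_ _ /chainP Hc] := is_flagP _ Hd.
apply/idP/idP => [Hi|].
  apply/subset_leq_card/subsetP => w; rewrite !inE => /andP[Hw Hjw].
  by rewrite Hw (subsetP (Hmin w Hw Hjw)).
apply: contraLR => Hi; rewrite -ltnNge; apply: proper_card; apply/properP; split.
  apply/subsetP => w; rewrite !inE => /andP[Hw Hiw]; rewrite Hw /=.
  have /orP[/subsetP ->//|/subsetP wu] := Hc u w Hu Hw.
  by rewrite wu in Hi.
by exists u; rewrite !inE Hu //= (negbTE Hi).
Qed.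

Lemma flag_labelsK : data_of_labels n flag_labels = d.
Proof.
have [H0 HN Hc] := is_flagP _ Hd.
rewrite [RHS]surjective_pairing; congr pair; apply/setP => u; last first.
  rewrite !inE lab_flag_labels /flag_label.
  by case: (_ \in _) => //; case: (depth _).
have Hup j v : 0 < depth j -> v \in d.1 -> j \in v ->
    (forall w, w \in d.1 -> j \in w -> v \subset w) -> upset flag_labels j = v.
  move=> Hj Hv Hjv Hmin; apply/setP => i.
  by rewrite !inE !lab_flag_labels label_le_flag // (depth_minimal i Hv Hjv Hmin).
apply/imsetP/idP => [[j]|Hu].
  rewrite inE lab_flag_labels unpainted_flag_label => Hj ->.
  by have [v [Hv Hjv Hmin]] := minimal_member Hj; rewrite (Hup j v).
have /set0Pn [i0 Hi0] := H0 u Hu.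
(* All points of [u] are at least as deep as a shallowest point [j], hence lie in the least member
   containing [j]; that member is therefore [u]. *)
case: (@arg_minnP _ i0 [pred i | i \in u] depth Hi0) => j /= Hj Hmin.
have Dj := depth_gt0 Hu Hj.
have [v [Hv Hjv Hvmin]] := minimal_member Dj.
exists j; first by rewrite inE lab_flag_labels unpainted_flag_label.
rewrite (Hup j v) //; apply/eqP; rewrite eqEsubset Hvmin // andbT.
by apply/subsetP => i Hi; rewrite (depth_minimal i Hv Hjv Hvmin) Hmin.
Qed.

(** Let [u] be the least member containing [i] and [v] the next larger one, which exists at depth at
    least two. A point of [v] outside [u] lies in the same members as [i] except [u]. Thus no level
    is skipped. *)
Lemma depth_pred i k : depth i = k.+2 -> exists j, depth j = k.+1.
Proof.
move=> Hi; have [u [Hu Hiu Humin]] : exists u, [/\ u \in d.1, i \in u &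
    forall w, w \in d.1 -> i \in w -> u \subset w] by apply: minimal_member; rewrite Hi.
have [_ _ Hc] := is_flagP _ Hd.
have [w0 Hw0 Hp0] : exists2 w, w \in d.1 & u \proper w.
  have : 0 < #|[set w in d.1 | i \in w] :\ u|.
    by move: Hi; rewrite /depth (cardsD1 u) inE Hu Hiu /= add1n => -[->].
  case/card_gt0P => w; rewrite !inE => /and3P[wu Hw Hiw]; exists w => //.
  by rewrite properEneq eq_sym wu Humin.
have [v [Hv Hpv Hvmin]] := @chain_min _ _ (fun w => u \proper w) w0 Hc Hw0 Hp0.
have /properP [_ [j Hjv Hju]] := Hpv; exists j.
suff E : [set w in d.1 | j \in w] = [set w in d.1 | i \in w] :\ u.
  rewrite /depth E; move: Hi.
  by rewrite /depth (cardsD1 u) inE Hu Hiu /= add1n => -[->].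
apply/setP => w; rewrite !inE; case Hw: (w \in d.1); rewrite ?andbF //=.
apply/idP/andP => [Hjw|[wu Hiw]].
  have wu : w != u by apply: contraNneq Hju => <-.
  split=> //; have /chainP/(_ u w Hu Hw)/orP[/subsetP -> //|/subsetP H] := Hc.
  by rewrite H in Hju.
have Hp : u \proper w by rewrite properEneq eq_sym wu Humin.
exact: (subsetP (Hvmin w Hw Hp)).
Qed.

Lemma flag_labels_valid : valid_labels n flag_labels /\ collapsed flag_labels.
Proof.
split; last first.
  apply/allP => l /mapP[i _ ->]; rewrite /flag_label.
  by case: (_ \in _) => //; case: (depth i).
apply/and3P; split; first by rewrite size_map size_enum_ord.
  apply/downclosedP => k j; rewrite mem_pmap => /mapP[l /mapP[i _ ->]].
  by rewrite /flag_label; case: (_ \in _) => [|[->]] //; case: (depth i).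
apply/downclosedP => k j; rewrite !mem_pmap => /mapP[l /mapP[i _ ->]] Hk.
have {Hk} : depth i = k.+1.
  move: Hk; rewrite /flag_label; case: (_ \in _) => //.
  by case: (depth i) => // ? [->].
move=> Hi jk; have [i' Hi'] : exists i', depth i' = j.+1.
  elim: k i Hi jk => // k IH i Hi; rewrite ltnS leq_eqVlt => /predU1P[->|].
    exact: depth_pred Hi.
  by have [i' Hi'] := depth_pred Hi; exact: IH Hi'.
apply/mapP; exists (Unpainted j) => //; apply/mapP; exists i'; rewrite ?mem_enum //.
by rewrite /flag_label depth_mem ?Hi'.
Qed.

End LabelsOfFlag.

Lemma data_of_labelsK n s : valid_labels n s -> collapsed s ->
  flag_labels (data_of_labels n s) = s.
Proof.
move=> Hv Hc; have Hsz : size s = n by case/and3P: Hv => /eqP.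
apply: (@eq_from_nth _ HalfPainted); first by rewrite size_map size_enum_ord.
rewrite size_map size_enum_ord => i Hi.
rewrite -[nth _ _ _]/(lab _ i.+1) -[RHS]/(lab s i.+1).
rewrite -[i]/(nat_of_ord (Ordinal Hi)) lab_flag_labels.
set j := Ordinal Hi; rewrite /flag_label inE.
have := lab_collapsed j.+1 Hc; case Ej: (lab s j.+1) => [k||k] //= _.
- suff -> : depth (data_of_labels n s) j = 0 by [].
  apply/eqP; rewrite cards_eq0; apply/eqP/setP => u; rewrite !inE.
  apply/negP => /andP[/imsetP[l]]; rewrite inE => Hl ->; rewrite inE Ej.
  by move: Hl; case: (lab s l.+1).
(* The members containing [j] are the final segments starting at the levels 0 to [k]. They are
   pairwise distinct because each level is inhabited, so the depth of [j] is [k.+1]. *)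
pose F (c : 'I_k.+1) := [set i : 'I_n | label_le (Unpainted c) (lab s i.+1)].
have Hcl (c : 'I_k.+1) : exists l : 'I_n, lab s l.+1 = Unpainted c.
  have Hk : Unpainted k \in s.
    by have := lab_mem Hv (ltn_ord j); rewrite Ej => -[].
  have : Unpainted c \in s.
    rewrite (mem_unpainted_label Hv); apply: leq_ltn_trans (_ : k < _).
      by rewrite -ltnS.
    by rewrite -(mem_unpainted_label Hv).
  by case/(lab_onto Hv) => -[|l] Hl El //; exists (Ordinal Hl).
suff -> : depth (data_of_labels n s) j = k.+1 by [].
have -> : depth (data_of_labels n s) j = #|[set F c | c : 'I_k.+1]|.
  congr #|pred_of_set _|; apply/setP => u; rewrite inE; apply/andP/imsetP.
    case=> /imsetP[l]; rewrite inE => Hl ->; rewrite inE Ej.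
    case El: (lab s l.+1) Hl => [|//|c] // _ Hck.
    have Hck' : c < k.+1.
      by move: Hck; rewrite /label_le /= label_eqE; lia.
    by exists (Ordinal Hck') => //; apply/setP => i'; rewrite !inE El.
  case=> c _ ->; have [l Hl] := Hcl c; split.
    apply/imsetP; exists l; first by rewrite inE Hl.
    by apply/setP => i'; rewrite !inE Hl.
  rewrite inE Ej /label_le /= label_eqE; have := ltn_ord c; lia.
rewrite card_imset ?card_ord // => c c' E.
have H (a b : 'I_k.+1) : F a = F b -> b <= a.
  move=> Eab; have [l Hl] := Hcl a.
  have : l \in F a by rewrite inE Hl label_le_refl.
  rewrite Eab inE Hl /label_le /= label_eqE; lia.
by apply/val_inj/eqP; rewrite eqn_leq !H.
Qed.

Definition flag_of_X n (x : X n) : flag n :=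
  exist _ (data_of_labels n (gap_labels (val x))) (data_of_labels_flag n _).

Definition X_of_flag n (d : flag n) : X n :=
  exist _ (build n (flag_labels (val d)))
    (build_X (proj1 (flag_labels_valid (valP d))) (proj2 (flag_labels_valid (valP d)))).

Lemma gap_labels_X_of_flag n (d : flag n) :
  gap_labels (val (X_of_flag d)) = flag_labels (val d).
Proof. by rewrite /= buildK // size_map size_enum_ord. Qed.

Lemma flag_of_XK n : cancel (@flag_of_X n) (@X_of_flag n).
Proof.
move=> x; apply: X_inj; rewrite gap_labels_X_of_flag /=.
by have [Hv Hc] := X_labelsP x; exact: data_of_labelsK.
Qed.

Lemma X_of_flagK n : cancel (@X_of_flag n) (@flag_of_X n).
Proof.
move=> d; apply/val_inj; rewrite [LHS]/= -[build _ _]/(val (X_of_flag d)).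
by rewrite gap_labels_X_of_flag; apply: flag_labelsK; exact: valP.
Qed.

Lemma growth_le_flag n (x y : X n) :
  growth_le y x <-> flag_le (flag_of_X y) (flag_of_X x).
Proof. by apply: iff_trans (growth_leP x y) _; exact: growsP. Qed.

(** * Marked tubings of complete graphs *)

Local Open Scope quotient_scope.

Section CompleteGraph.
Variable n : nat.
Local Notation K := (complete_graph n).
Implicit Types (u v w : {set K}) (U V : premarked K).

Lemma tube_complete u : tube u = (u != set0).
Proof.
rewrite /tube; case: (u != set0) => //=.
apply/forall_inP => x Hx; apply/forall_inP => y Hy.
have [->|xy] := eqVneq x y; first exact: connect0.
by apply: connect1; rewrite /= Hx Hy.
Qed.

Lemma compatible_complete u v : u != set0 ->
  compatible u v = (u \subset v) || (v \subset u).
Proof.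
move=> Hu; rewrite /compatible tube_complete setU_eq0 negb_and Hu /=.
by rewrite andbF orbF.
Qed.

Lemma marked_tubing_completeP U : reflect
  [/\ forall u, U u != None -> u != set0,
      U setT != None,
      forall u v, U u != None -> U v != None -> (u \subset v) || (v \subset u)
    & forall u v, U u != None -> U v != None -> u \proper v ->
        U v != Some Thick -> U u = Some Thin]
  (is_marked_tubing U).
Proof.
apply: (iffP andP) => [[/and3P[/forall_inP H0 HT /forall_inP Hc] /forall_inP Hm]|].
  have H0' u : U u != None -> u != set0.
    by move=> Hu; rewrite -tube_complete; apply: H0; rewrite inE.
  split=> //; first by rewrite inE in HT.
    move=> u v Hu Hv; rewrite -compatible_complete ?H0' //.
    have /forall_inP H : [forall v in tubes U, compatible u v] by apply: Hc; rewrite inE.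
    by apply: H; rewrite inE.
  move=> u v Hu Hv uv Hv'.
  have /Hm /forall_inP H : u \in tubes U by rewrite inE.
  have /H /implyP : v \in tubes U by rewrite inE.
  by rewrite uv Hv' => /(_ isT) /eqP.
case=> H0 HT Hc Hm; split; first apply/and3P; first split.
- by apply/forall_inP => u; rewrite inE tube_complete; exact: H0.
- by rewrite inE.
- apply/forall_inP => u; rewrite inE => Hu; apply/forall_inP => v; rewrite inE => Hv.
  by rewrite compatible_complete ?Hc // H0.
- apply/forall_inP => u; rewrite inE => Hu; apply/forall_inP => v; rewrite inE => Hv.
  by apply/implyP => /andP[uv Hv']; apply/eqP; exact: (Hm u v).
Qed.

Definition nonthick U u := (U u == Some Thin) || (U u == Some Broken).

Definition flag_data_of U : flag_data n :=
  ([set u | U u == Some Thin], \bigcup_(u | nonthick U u) u).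

Lemma nonthick_tube U u : nonthick U u -> U u != None.
Proof. by case/orP => /eqP ->. Qed.

Lemma nonthickE U u : nonthick U u = (U u != None) && (U u != Some Thick).
Proof. by rewrite /nonthick; case: (U u) => [[]|]. Qed.

Section OneTubing.
Variable U : premarked K.
Hypothesis HU : is_marked_tubing U.
Let N := (flag_data_of U).2.

Lemma nonthick_sub u : nonthick U u -> u \subset N.
Proof. exact: bigcup_sup. Qed.

(** The nonthick tubes form a finite chain, so their union is the largest of them. *)
Lemma nonthick_union : N != set0 -> nonthick U N.
Proof.
case/set0Pn => x /bigcupP[u0 Hu0 _]; have [_ _ Hc _] := marked_tubing_completeP _ HU.
have HA : chain [set u : {set 'I_n} | nonthick U u].
  by apply/chainP => u v; rewrite !inE => /nonthick_tube Hu /nonthick_tube Hv; exact: Hc.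
have Hu0' : u0 \in [set u : {set 'I_n} | nonthick U u] by rewrite inE.
have [u [Hu _ Hmax]] := @chain_max _ _ predT u0 HA Hu0' isT.
rewrite inE in Hu; suff -> : N = u by [].
apply/eqP; rewrite eqEsubset nonthick_sub // andbT.
by apply/bigcupsP => w Hw; apply: Hmax; rewrite ?inE.
Qed.

(** A tube properly containing a broken one is thick, so a broken tube is the largest nonthick
    tube. *)
Lemma broken_union u : U u = Some Broken -> u = N.
Proof.
move=> Hu; have Hnu : nonthick U u by rewrite /nonthick Hu eqxx orbT.
apply/eqP; rewrite eqEsubset nonthick_sub //=.
apply/bigcupsP => w; have [_ _ Hc Hm] := marked_tubing_completeP _ HU.
rewrite nonthickE => /andP[Hw1 Hw2].
have Hu1 : U u != None by rewrite Hu.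
have /orP[//|uw] := Hc w u Hw1 Hu1.
have [<-//|wu] := eqVneq u w.
by have := Hm u w Hu1 Hw1; rewrite properEneq wu uw Hu => /(_ isT Hw2).
Qed.

Lemma flag_data_of_flag : is_flag (flag_data_of U).
Proof.
have [H0 _ Hc _] := marked_tubing_completeP _ HU.
apply/is_flagP; split=> /=.
- by move=> u; rewrite inE => /eqP Hu; apply: H0; rewrite Hu.
- by move=> u; rewrite inE => Hu; apply: nonthick_sub; rewrite /nonthick Hu.
- by apply/chainP => u v; rewrite !inE => /eqP Hu /eqP Hv; apply: Hc; rewrite ?Hu ?Hv.
Qed.

End OneTubing.

(** The representative with the fewest thick tubes. The order of the tests matters: [d.2] is broken
    only when it is not thin, and the universal tube is thick only when it is neither thin nor
    [d.2]. There is no broken tube when [d.2] is empty. *)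
Definition canonical_marking (d : flag_data n) : premarked K :=
  [ffun u => if u \in d.1 then Some Thin
             else if (u == d.2) && (u != set0) then Some Broken
             else if u == setT then Some Thick else None].

Lemma union_notin U u : is_marked_tubing U -> ~~ nonthick U u ->
  (u == (flag_data_of U).2) && (u != set0) = false.
Proof.
move=> HU Hu; apply/negP => /andP[/eqP E u0]; move/negP: Hu; apply.
by rewrite E; apply: nonthick_union => //; rewrite -E.
Qed.

Lemma canonical_marking_data U : is_marked_tubing U ->
  (forall u, U u = Some Thick -> u = setT) ->
  canonical_marking (flag_data_of U) = U.
Proof.
move=> HU Hthick; have [H0 HT _ _] := marked_tubing_completeP _ HU.
apply/ffunP => u; rewrite ffunE inE; set N := (flag_data_of U).2.
case E: (U u) => [[]|] //=.
- by rewrite union_notin ?nonthickE ?E // (Hthick u E) eqxx.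
- have <- : u = N := broken_union HU E.
  by rewrite eqxx H0 ?E.
- rewrite union_notin ?nonthickE ?E //; case: eqP => // uT.
  by rewrite -uT E in HT.
Qed.

(** The universal tube has to be nonempty for a marked tubing to exist. *)
Hypothesis n_gt0 : 0 < n.

Lemma setT_neq0 : [set: K] != set0.
Proof. by apply/set0Pn; exists (Ordinal n_gt0). Qed.

Lemma is_flagE (d : flag_data n) : is_flag d ->
  [/\ forall u, u \in d.1 -> u != set0, forall u, u \in d.1 -> u \subset d.2
    & forall u v, u \in d.1 -> v \in d.1 -> (u \subset v) || (v \subset u)].
Proof. by case/is_flagP => H0 HN /chainP Hc; split=> // u v; exact: Hc. Qed.

Lemma canonical_marking_tubing d : is_flag d ->
  is_marked_tubing (canonical_marking d).
Proof.
case/is_flagE => H0 HN Hc; set U := canonical_marking d.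
have HU u : U u != None -> [\/ u \in d.1, u = d.2 /\ u != set0 | u = setT].
  rewrite ffunE; case: ifP => [? _|_]; first by constructor 1.
  case: ifP => [/andP[/eqP ? ?] _|_]; first by constructor 2.
  by case: ifP => // /eqP ? _; constructor 3.
apply/marked_tubing_completeP; split.
- by move=> u /HU [/H0 //|[] //|->]; exact: setT_neq0.
- by rewrite ffunE eqxx; case: ifP => // _; case: ifP.
- move=> u v /HU Hu /HU Hv.
  case: Hv => [Hv|[-> _]|->]; last by rewrite (subsetT u).
    case: Hu => [Hu|[-> _]|->]; [exact: Hc | by rewrite (HN v) ?orbT |].
    by rewrite (subsetT v) orbT.
  case: Hu => [Hu|[-> _]|->]; [by rewrite HN | by rewrite subxx |].
  by apply/orP; right; exact: subsetT.
- move=> u v /HU Hu /HU Hv uv Hv'.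
  have vN : v \subset d.2.
    case: Hv => [/HN //|[-> _] //|vT].
    move: Hv'; rewrite ffunE vT eqxx; case: ifP => [/HN //|_].
    by case: ifP => // /andP[/eqP -> _].
  have uN := proper_sub_trans uv vN.
  rewrite ffunE; case: Hu => [->//|[uN' _]|uT]; first by rewrite uN' properxx in uN.
  by rewrite uT /proper subsetT andbF in uv.
Qed.

Lemma flag_data_canonical d : is_flag d ->
  flag_data_of (canonical_marking d) = d.
Proof.
move=> Hd; have [H0 HN Hc] := is_flagE Hd; set U := canonical_marking d.
have Hthin u : (U u == Some Thin) = (u \in d.1).
  by rewrite ffunE; case: ifP => // _; do 2?case: ifP.
rewrite [RHS]surjective_pairing; congr pair; first by apply/setP => u; rewrite inE Hthin.
apply/eqP; rewrite eqEsubset; apply/andP; split.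
  apply/bigcupsP => u; rewrite /nonthick Hthin => /orP[/HN //|].
  rewrite ffunE; case: ifP => // _; case: ifP => [/andP[/eqP ->] //|_].
  by case: ifP.
have [->|N0] := eqVneq d.2 set0; first exact: sub0set.
apply: (@nonthick_sub U d.2); rewrite /nonthick Hthin; case Hin: (d.2 \in d.1) => //=.
by rewrite ffunE Hin eqxx N0.
Qed.

(** * Classes of marked tubings as flags *)

Definition flag_of_tubing (U : marked_tubing K) : flag n :=
  exist _ (flag_data_of (val U)) (flag_data_of_flag (valP U)).

Definition tubing_of_flag (d : flag n) : marked_tubing K :=
  exist _ (canonical_marking (val d)) (canonical_marking_tubing (valP d)).

Lemma tubing_of_flagK : cancel tubing_of_flag flag_of_tubing.
Proof. by move=> d; apply/val_inj/flag_data_canonical; exact: valP. Qed.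

Lemma eq_flag_data U V :
  (forall u, (U u == Some Thin) = (V u == Some Thin)) ->
  (forall u, (U u == Some Broken) = (V u == Some Broken)) ->
  flag_data_of U = flag_data_of V.
Proof.
move=> Ht Hb; congr pair; first by apply/setP => u; rewrite !inE Ht.
by apply: eq_bigl => u; rewrite /nonthick Ht Hb.
Qed.

Lemma add_thick_flag (U V : marked_tubing K) : add_thick U V ->
  flag_of_tubing U = flag_of_tubing V.
Proof.
case/existsP => u /existsP[v /and4P[_ /eqP Hu _ /eqP E]]; apply/val_inj => /=.
rewrite E; apply: eq_flag_data => w; rewrite ffunE inE; case: ifP => // /eqP ->;
  by rewrite Hu.
Qed.

Lemma thick_equiv_flag (U V : marked_tubing K) : thick_equiv U V ->
  flag_of_tubing U = flag_of_tubing V.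
Proof.
case/connectP => p + ->; elim: p U => //= W p IH U /andP[HUW /IH <-].
by case/orP: HUW => /add_thick_flag.
Qed.

(** Thick tubes other than the universal one can be deleted one at a time; each deletion is undone
    by [add_thick], and the canonical representative is reached in the end. *)
Lemma thick_equiv_canonical (U : marked_tubing K) :
  thick_equiv (tubing_of_flag (flag_of_tubing U)) U.
Proof.
move: {2}#|_| (leqnn #|[set u | (val U u == Some Thick) && (u != setT)]|) => m.
elim: m U => [|m IH] U Hm.
  suff -> : tubing_of_flag (flag_of_tubing U) = U by exact: thick_equiv_refl.
  apply/val_inj/canonical_marking_data; first exact: valP.
  move=> u Hu; apply/eqP; rewrite -[_ == _]negbK; apply/negP => uT.
  move: Hm; rewrite leqn0 cards_eq0 => /eqP/setP/(_ u).
  by rewrite !inE Hu uT.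
have [E|[u]] := set_0Vmem [set u | (val U u == Some Thick) && (u != setT)].
  by apply: IH; rewrite E cards0.
rewrite inE => /andP[/eqP Hu uT].
have [H0 HT Hc Ht] := marked_tubing_completeP _ (valP U).
have Hu0 : val U u != None by rewrite Hu.
pose V : premarked K := [ffun w => if w == u then None else val U w].
have HV w : V w != None -> val U w != None /\ V w = val U w.
  by rewrite ffunE; case: ifP.
have VV : is_marked_tubing V.
  apply/marked_tubing_completeP; split.
  - by move=> w /HV [/H0].
  - by rewrite ffunE (eq_sym setT u) (negbTE uT).
  - by move=> w w' /HV [Hw _] /HV [Hw' _]; exact: Hc.
  - by move=> w w' /HV [Hw ->] /HV [Hw' ->]; exact: Ht.
pose V' : marked_tubing K := exist _ V VV.
have uTp : u \proper setT by rewrite properE subsetT subTset.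
have HVU : add_thick V' U.
  apply/existsP; exists u; apply/existsP; exists setT; rewrite uTp /=.
  apply/and3P; split; first by rewrite ffunE eqxx.
    (* The universal tube is thick, since otherwise the thick tube [u] inside it would have to be
       thin. *)
    rewrite ffunE (eq_sym setT u) (negbTE uT); apply: contraT => HT'.
    by have := Ht u setT Hu0 HT uTp HT'; rewrite Hu.
  by apply/eqP/ffunP => w; rewrite ffunE inE /= /V ffunE; case: eqP => [->|].
rewrite -(add_thick_flag HVU); apply: thick_equiv_trans (IH V' _) _; last first.
  by apply: connect1; rewrite HVU.
rewrite -ltnS; apply: leq_trans Hm; apply: proper_card; apply/properP; split.
  by apply/subsetP => w; rewrite !inE ffunE; case: ifP.
by exists u; rewrite !inE ?Hu ?uT // ffunE eqxx.
Qed.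

Lemma face_eqP (U V : marked_tubing K) :
  \pi_(cubeahedron_face K) U = \pi_(cubeahedron_face K) V <->
  flag_of_tubing U = flag_of_tubing V.
Proof.
split=> [/eqmodP /thick_equiv_flag //|E]; apply/eqmodP.
apply: thick_equiv_trans (thick_equiv_canonical V).
by rewrite -E [X in is_true X]thick_equiv_sym; exact: thick_equiv_canonical.
Qed.

Definition flag_of_face (c : cubeahedron_face K) : flag n := flag_of_tubing (repr c).
Definition face_of_flag (d : flag n) : cubeahedron_face K :=
  \pi_(cubeahedron_face K) (tubing_of_flag d).

Lemma flag_of_pi (U : marked_tubing K) :
  flag_of_face (\pi_(cubeahedron_face K) U) = flag_of_tubing U.
Proof. by apply/face_eqP; rewrite reprK. Qed.

Lemma face_of_flagK : cancel face_of_flag flag_of_face.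
Proof. by move=> d; rewrite flag_of_pi tubing_of_flagK. Qed.

Lemma flag_of_faceK : cancel flag_of_face face_of_flag.
Proof.
move=> c; rewrite -[RHS]reprK; apply/face_eqP.
by rewrite tubing_of_flagK.
Qed.

(** * Moves and the order on flags *)

Lemma move_flag_le (V U : marked_tubing K) : move V U ->
  flag_le (flag_of_tubing U) (flag_of_tubing V).
Proof.
case.
- case=> u [m [Hu Hm E]]; rewrite /flag_le /= E; split.
    apply/subsetP => w; rewrite !inE ffunE inE; case: ifP => // /eqP ->.
    by rewrite Hu.
  apply/bigcupsP => w; rewrite /nonthick ffunE inE; case: ifP => [/eqP -> _|_ Hw].
    by apply: nonthick_sub; rewrite /nonthick Hu orbT.
  exact: nonthick_sub.
- case=> u [v [uv Hu Hv E]]; rewrite /flag_le /= E; split.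
    by apply/subsetP => w; rewrite !inE ffunE inE; case: ifP.
  apply/bigcupsP => w; rewrite /nonthick ffunE inE; case: ifP => [/eqP -> _|_ Hw].
    apply: subset_trans (proper_sub uv) _; apply: nonthick_sub.
    by rewrite /nonthick; case: Hv => ->; rewrite ?orbT.
  exact: nonthick_sub.
- by move/add_thick_flag => ->; exact: flag_le_refl.
(* The new broken tubes lie inside [v], which was broken before, so the union of the nonthick tubes
   cannot grow. *)
- case=> v [A [Hv HA E]]; rewrite /flag_le /= E; split.
    apply/subsetP => w; rewrite !inE !ffunE inE; case: ifP => [/eqP ->|_].
      by rewrite Hv.
    by case: ifP => // /HA [->].
  apply/bigcupsP => w; rewrite /nonthick !ffunE inE; case: ifP => // _.
  case: ifP => [/HA [_ /andP[/proper_sub wv _]] _|_]; last exact: nonthick_sub.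
  apply: subset_trans wv _; apply: nonthick_sub.
  by rewrite /nonthick Hv orbT.
Qed.

Lemma face_le_flag_le (c d : cubeahedron_face K) :
  face_le c d -> flag_le (flag_of_face c) (flag_of_face d).
Proof.
elim=> {c d} [c d [U [V [-> -> H]]]|c|c d e _ H1 _ H2].
- rewrite !flag_of_pi; elim: H => [V' U' /move_flag_le //|W|V1 V2 V3 _ H1 _ H2].
    exact: flag_le_refl.
  exact: flag_le_trans H1.
- exact: flag_le_refl.
- exact: flag_le_trans H2.
Qed.

Lemma move_face_le (V U : marked_tubing K) d d' : move V U ->
  flag_of_tubing V = d -> flag_of_tubing U = d' ->
  face_le (face_of_flag d') (face_of_flag d).
Proof.
move=> H <- <-; apply: Relation_Operators.rt_step; exists U, V.
split; [| |exact: Relation_Operators.rt_step];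
  by apply/face_eqP; rewrite tubing_of_flagK.
Qed.

(** If [u] is the whole union, it is the broken tube of the canonical representative and becomes
    thin. Otherwise it is a new thin tube inside the union, which is thin or broken. *)
Lemma add_thin_move (d d' : flag n) u :
  val d' = (u |: (val d).1, (val d).2) -> u \notin (val d).1 ->
  move (tubing_of_flag d) (tubing_of_flag d').
Proof.
move=> Ed Hu; have [H0 HN _] := is_flagE (valP d').
have u0 : u != set0 by apply: H0; rewrite Ed !inE eqxx.
have uN : u \subset (val d).2 by have := HN u; rewrite Ed !inE eqxx; apply.
have EU : val (tubing_of_flag d') = set_mark (val (tubing_of_flag d)) [set u] Thin.
  apply/ffunP => w; rewrite /= !ffunE Ed /= !inE.
  by case: (w == u).
have [E|uN'] := eqVneq u (val d).2.
  constructor 1; exists u, Thin; split=> //.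
  by rewrite /= ffunE (negbTE Hu) E eqxx /= -E u0.
constructor 2; exists u, (val d).2; split=> //.
- by rewrite properEneq uN' uN.
- rewrite /= ffunE (negbTE Hu) (negbTE uN') /=; case: eqP => // uT.
  by case/negP: uN'; rewrite eqEsubset uN uT (subsetT (val d).2).
- rewrite /= ffunE; case: ifP => _; [by left | right].
  by rewrite eqxx /= ifT //; apply: contraNneq u0 => E; rewrite -subset0 -E.
Qed.

(** The missing tubes can be added in any order: each intermediate family is a subfamily of the
    larger chain, hence a chain. *)
Lemma face_le_grow_thin (d d' : flag n) :
  (val d).1 \subset (val d').1 -> (val d').2 = (val d).2 ->
  face_le (face_of_flag d') (face_of_flag d).
Proof.
move=> Hs E2; move: {2}#|_| (leqnn #|(val d').1 :\: (val d).1|) => m.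
elim: m d Hs E2 => [|m IH] d Hs E2 Hm.
  have -> : d' = d; last exact: Relation_Operators.rt_refl.
  move: Hm; rewrite leqn0 cards_eq0 setD_eq0 => Hs'; apply/val_inj.
  rewrite [LHS]surjective_pairing [RHS]surjective_pairing E2; congr pair.
  by apply/eqP; rewrite eqEsubset Hs Hs'.
have [E|[u]] := set_0Vmem ((val d').1 :\: (val d).1).
  by apply: IH; rewrite ?E ?cards0.
move=> Hu; have := Hu; rewrite inE => /andP[uN uI].
have He : is_flag (u |: (val d).1, (val d).2).
  have Hsub : u |: (val d).1 \subset (val d').1 by rewrite subUset sub1set uI.
  have [H0 HN Hc] := is_flagE (valP d'); apply/is_flagP; split=> /=.
  - by move=> w /(subsetP Hsub); exact: H0.
  - by move=> w /(subsetP Hsub); rewrite -E2; exact: HN.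
  - by apply/chainP => v w /(subsetP Hsub) Hv /(subsetP Hsub); exact: Hc.
pose e : flag n := exist _ (u |: (val d).1, (val d).2) He.
apply: Relation_Operators.rt_trans (IH e _ _ _) _ => //=.
- by rewrite subUset sub1set uI.
- rewrite -ltnS; apply: leq_trans Hm; apply: proper_card; apply/properP; split.
    by apply: setDS; exact: subsetUr.
  by exists u => //; rewrite !inE eqxx.
apply: move_face_le (add_thin_move (d := d) (d' := e) erefl uN) _ _; exact: tubing_of_flagK.
Qed.

(** One split suffices. All thin tubes lie in the smaller union, so the larger one is not thin and
    is therefore broken; it becomes thick while the smaller union is added as a broken tube, closely
    nested because nothing lies between the two. *)
Lemma face_le_shrink (d d' : flag n) :
  (val d').1 = (val d).1 -> (val d').2 \proper (val d).2 ->
  face_le (face_of_flag d') (face_of_flag d).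
Proof.
move=> E1 HN'; have [H0 HN Hc] := is_flagE (valP d').
set Th := (val d').1 in E1 H0 HN Hc; set N' : {set K} := (val d').2 in HN HN' *.
set N : {set K} := (val d).2 in HN' *.
have NTh : N \notin Th.
  by apply/negP => /HN NN'; rewrite /proper NN' andbF in HN'.
have N'N : N' != N by move: HN'; rewrite properEneq => /andP[].
have N0 : N != set0.
  by apply: contraTneq HN' => ->; rewrite /proper sub0set andbF.
pose V := tubing_of_flag d.
(* At most the one tube [N']. If [N'] is empty or already thin, no tube is added and [N] just
   becomes thick. *)
pose A := [set w : {set K} | [&& w == N', w != set0 & w \notin Th]].
pose U := set_mark (set_mark (val V) A Broken) [set N] Thick.
have UE w : U w = if w \in Th then Some Thin else if w == N then Some Thick
    else if (w == N') && (w != set0) then Some Broken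
    else if w == setT then Some Thick else None.
  rewrite /U !ffunE !inE -E1 -/N.
  case wT: (w \in Th); case wN: (w == N) => //=; rewrite ?andbF ?andbT //.
  by rewrite -(eqP wN) wT in NTh.
have UC w : U w != None -> [\/ w \in Th, w = N' /\ w != set0, w = N | w = setT].
  rewrite UE; case: ifP => [? _|_]; first by constructor 1.
  case: ifP => [/eqP -> _|_]; first by constructor 3.
  case: ifP => [/andP[/eqP -> ?] _|_]; first by constructor 2.
  by case: ifP => // /eqP -> _; constructor 4.
have UN v : U v != None -> U v != Some Thick -> v \subset N'.
  rewrite UE; case: ifP => [/HN //|_]; case: ifP => // _.
  by case: ifP => [/andP[/eqP -> _]|_] //; case: ifP.
have HU : is_marked_tubing U.
  apply/marked_tubing_completeP; split.
  - by move=> w /UC [/H0|[]|->|->] //; exact: setT_neq0.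
  - by rewrite UE eqxx; do 3?case: ifP => // _.
  - have Hle v w : U v != None -> U w != None ->
        (v \subset w) || (w \subset v) || [&& v \in Th & w \in Th].
      have N'N' := proper_sub HN'.
      have HNN v' : v' \in Th -> v' \subset N by move/HN/subset_trans; apply.
      move=> /UC Hv /UC Hw.
      case: Hw => [Hw|[-> _]|->|->]; last by rewrite (subsetT v).
      + case: Hv => [Hv|[-> _]|->|->]; [by rewrite Hv Hw orbT| | |].
        * by rewrite (HN w Hw) orbT.
        * by rewrite (HNN w Hw) orbT.
        * by rewrite (subsetT w) orbT.
      + case: Hv => [Hv|[-> _]|->|->]; [by rewrite HN|by rewrite subxx| |].
        * by rewrite N'N' orbT.
        * by rewrite (subsetT N') orbT.
      + case: Hv => [Hv|[-> _]|->|->]; [by rewrite HNN|by rewrite N'N'|by rewrite subxx|].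
        by rewrite (subsetT N) orbT.
    by move=> v w Hv Hw; have /orP[//|/andP[]] := Hle v w Hv Hw; exact: Hc.
  - move=> v w Hv Hw vw Hw'; have vN := proper_sub_trans vw (UN w Hw Hw').
    have := UE v; case: (UC v Hv) => [-> //|[vN' _]|vN'|vT].
    + by rewrite vN' properxx in vN.
    + by rewrite vN' in vN; have := proper_trans vN HN'; rewrite properxx.
    + by rewrite vT /proper (subsetT N') andbF in vN.
pose U' : marked_tubing K := exist _ U HU.
have Uthin w : (U w == Some Thin) = (w \in Th).
  by rewrite UE; case: ifP => // _; do 3?case: ifP => // _.
have Hmove : move V U'.
  constructor 4; exists N, A; split=> //.
    by rewrite /= ffunE -E1 (negbTE NTh) eqxx N0.
  move=> w; rewrite inE => /and3P[/eqP -> N'0 N'Th]; split.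
    rewrite /= ffunE -E1 (negbTE N'Th) -/N (negbTE N'N) /=.
    case: eqP => // N'T; by rewrite N'T /proper (subsetT N) andbF in HN'.
  rewrite /closely_nested HN'; apply/forall_inP => v; rewrite inE => /= Hv.
  apply/negP => /andP[N'v vN]; move: (Hv); case: (UC v Hv) => [/HN vN'|[vN' _]|vN'|vT] _.
  - by have := proper_sub_trans N'v vN'; rewrite properxx.
  - by rewrite vN' properxx in N'v.
  - by rewrite vN' properxx in vN.
  - by rewrite vT /proper (subsetT N) andbF in vN.
apply: (move_face_le Hmove); first exact: tubing_of_flagK.
apply/val_inj; rewrite [RHS]surjective_pairing; congr pair.
  by apply/setP => w; rewrite inE Uthin.
apply/eqP; rewrite eqEsubset; apply/andP; split.
  apply/bigcupsP => w; rewrite nonthickE => /andP[]; exact: UN.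
have [E0|N'0] := eqVneq N' set0; first by rewrite -/N' E0; exact: sub0set.
apply: (@nonthick_sub U N'); rewrite nonthickE UE; case: ifP => // _.
by rewrite (negbTE N'N) eqxx N'0.
Qed.

(** The intermediate flag has the old chain and the new union. It is a flag because the old chain is
    part of the new one, whose members lie in the new union. *)
Lemma flag_le_face_le (d d' : flag n) :
  flag_le d' d -> face_le (face_of_flag d') (face_of_flag d).
Proof.
case=> H1 H2; have He : is_flag ((val d).1, (val d').2).
  have [H0 HN Hc] := is_flagE (valP d'); apply/is_flagP; split=> /=.
  - by move=> w /(subsetP H1); exact: H0.
  - by move=> w /(subsetP H1); exact: HN.
  - by apply/chainP => v w /(subsetP H1) Hv /(subsetP H1); exact: Hc.
pose e : flag n := exist _ ((val d).1, (val d').2) He.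
apply: Relation_Operators.rt_trans (face_le_grow_thin (d := e) (d' := d') H1 erefl) _.
have [E|N'N] := eqVneq (val d').2 (val d).2.
  suff -> : e = d by exact: Relation_Operators.rt_refl.
  by apply/val_inj; rewrite /= E -surjective_pairing.
by apply: face_le_shrink => //; rewrite properEneq N'N.
Qed.

Lemma face_leP (c d : cubeahedron_face K) :
  face_le c d <-> flag_le (flag_of_face c) (flag_of_face d).
Proof.
split; first exact: face_le_flag_le.
by move/flag_le_face_le; rewrite !flag_of_faceK.
Qed.

End CompleteGraph.

(** Orders pull back along bijections that preserve and reflect them, so the order axioms on both
    sides, antisymmetry included, come from [D]. *)
Lemma poset_isomorphic_via (S T D : Type) (leS : S -> S -> Prop)
    (leT : T -> T -> Prop) (leD : D -> D -> Prop)
    (a : S -> D) (a' : D -> S) (b : T -> D) (b' : D -> T) :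
    Relation_Definitions.order D leD ->
    cancel a a' -> cancel a' a -> cancel b b' -> cancel b' b ->
    (forall x y, leS x y <-> leD (a x) (a y)) ->
    (forall x y, leT x y <-> leD (b x) (b y)) ->
  poset_isomorphic leS leT.
Proof.
case=> Dr Dt Da aK a'K bK b'K HS HT.
have ord (R : Type) leR (f : R -> D) (f' : D -> R) : cancel f f' ->
    (forall x y, leR x y <-> leD (f x) (f y)) -> Relation_Definitions.order R leR.
  move=> fK HR; split=> [x|x y z /HR xy /HR yz|x y /HR xy /HR yx].
  - by apply/HR.
  - by apply/HR; exact: Dt yz.
  - by apply: (can_inj fK); exact: Da.
split; [exact: ord aK HS | exact: ord bK HT |].
exists (b' \o a) => [|x y]; last by rewrite HS HT /= !b'K.
by exists (a' \o b) => z /=; rewrite ?b'K ?aK ?a'K ?bK.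
Qed.

Theorem theorem4p14 (n : nat) (hn : 1 <= n) :
  poset_isomorphic (@growth_le n) (@face_le (complete_graph n)).
Proof.
apply: (@poset_isomorphic_via _ _ (flag n) _ _ (@flag_le n)
  (@flag_of_X n) (@X_of_flag n) (@flag_of_face n) (@face_of_flag n hn)).
- split=> [d|d e f|d e]; [exact: flag_le_refl | exact: flag_le_trans | exact: flag_le_anti].
- exact: flag_of_XK.
- exact: X_of_flagK.
- exact: flag_of_faceK.
- exact: face_of_flagK.
- by move=> x y; exact: growth_le_flag.
- by move=> c d; exact: face_leP.
Qed.
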